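(* Let $d\ge 1$, $p\in(0,1]$, $s\in[p,2]$, $P=\lfloor d(p^{-1}-1)\rfloor$, and let $X\subset\mathbb{R}^d$ be a convex Lipschitz domain equipped with Lebesgue measure. Let $\{\varphi_n\}_{n\in\mathbb{N}^d}$ be an orthonormal basis of $L^2(X)$ such that $\varphi_n\in\Lambda_{d(\frac1p-1)}(X)$ for every $n$. For $r\in(0,1)$ let $R_r f=\sum_{n\in\mathbb{N}^d} r^{|n|}\langle f,\varphi_n\rangle\varphi_n$, and assume that $R_r$ is an integral operator, $R_rf(y)=\int_X R_r(x,y)f(x)\,dx$, whose kernel $R_r(x,y)$ is of class $\mathcal{C}^P(X)$ as a function of $x$ for every $y\in X$. Assume moreover that there exist a constant $\gamma>0$ and a finite set $\Delta$ of positive numbers, each strictly greater than $d(p^{-1}-1)-P$, such that for each $k=0,\ldots,P$ there is a constant $C_k$ with $$\Big\| R_r(x,\cdot)-\sum_{|n|\le k}\frac{\partial_x^{n}R_r(x',\cdot)}{n_1!\cdots n_d!}\prod_{j=1}^d(x_j-x_j')^{n_j}\Big\|_{L^2(X)}\le C_k\sum_{\delta\in\Delta}(1-r)^{-(d+2k+2\delta)\gamma}|x-x'|^{k+\delta}$$ for all $r\in(0,1)$ and all $x,x'\in X$ with $|x-x'|\le 1/2$. Then there is a constant $C$ such that $$\sum_{n\in\mathbb{N}^d}\frac{|\langle f,\varphi_n\rangle|^s}{(|n|+1)^E}\le C\,\|f\|^s_{H^p(X)}\qquad\text{for all } f\in H^p(X),$$ where $$E=\frac{(2-p)sd\gamm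a}{p}+\frac{(2-s)d}{2}.$$
   Context: $\mathbb{N}=\{0,1,2,\ldots\}$; $|n|=n_1+\ldots+n_d$ for $n\in\mathbb{N}^d$; $\partial_x^n=\partial_{x_1}^{n_1}\cdots\partial_{x_d}^{n_d}$, and $\partial_x^nR_r(x',\cdot)$ is the derivative in the first variable evaluated at $x'$. A convex Lipschitz domain is a convex open connected set with Lipschitz boundary (the boundary condition matters only for $d\ge2$). Hardy spaces. For $p\in(0,1]$, $H^p(\mathbb{R}^d)$ is the real Hardy space of distributions $f$ with $\sup_{t>0}|f*\Phi_t|\in L^p(\mathbb{R}^d)$, where $\Phi$ is a fixed Schwartz function with $\int\Phi\ne0$, $\Phi_t(x)=t^{-d}\Phi(x/t)$. For $q\in[1,\infty]$, $q>p$, a $(p,q)$-atom is a measurable function $a$ supported in a Euclidean ball $B$ with $\|a\|_{L^q}\le|B|^{1/q-1/p}$ and $\int_B a(x)x^n\,dx=0$ for all multi-indices $|n|\le\lfloor d(p^{-1}-1)\rfloor$. Every $f\in H^p(\mathbb{R}^d)$ can be written as $f=\sum_j\lambda_ja_j$ with atoms $a_j$ and $\sum_j|\lambda_j|^p<\infty$, and $\|f\|_{H^p(\mathbb{R}^d)}=\inf(\sum_j|\lambda_j|^p)^{1/p}$ over all such decompositions (different $q$ give equivalent quantities). $H^p(X)$ is the set of all $f=F|_X$ with $F\in H^p(\mathbb{R}^d)$, $\mathrm{supp}\,F\subset\overline X$; each such $f$ has an atomic decomposition with atoms supported in $X$, and $\|f\|_{H^p(X)}=\inf(\sum_j|\lambda_j|^p)^{1/p}$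 over such decompositions. Lipschitz spaces. For $\nu>0$, $\nu\notin\mathbb{N}$, $\Lambda_\nu(\mathbb{R}^d)$ consists of bounded $g\in\mathcal{C}^{\lfloor\nu\rfloor}(\mathbb{R}^d)$ with $\|g\|_{\Lambda_\nu(\mathbb{R}^d)}=\|g\|_\infty+\max_{|n|=\lfloor\nu\rfloor}\sup_{x,h}|\partial^ng(x+h)-\partial^ng(x)|/|h|^{\nu-\lfloor\nu\rfloor}<\infty$; for integer $\nu\ge1$ it consists of bounded $g\in\mathcal{C}^{\nu-1}(\mathbb{R}^d)$ with $\|g\|_{\Lambda_\nu(\mathbb{R}^d)}=\|g\|_\infty+\max_{|n|=\nu-1}\sup_{x,h}|\partial^ng(x+h)-2\partial^ng(x)+\partial^ng(x-h)|/|h|<\infty$ ($h\neq0$); $\Lambda_0(\mathbb{R}^d)=BMO(\mathbb{R}^d)$. $\Lambda_\nu(X)$ is the space of restrictions to $X$ of elements of $\Lambda_\nu(\mathbb{R}^d)$. Pairing. $\langle f,\varphi_n\rangle=\int_Xf\overline{\varphi_n}\,dx$ whenever this makes sense; for general $f\in H^p(X)$ it denotes the value at $f$ of the bounded linear functional on $H^p(X)$ given by the $H^p$–$\Lambda_{d(1/p-1)}$ duality, i.e. $\langle f,\varphi_n\rangle=\sum_j\lambda_j\int_Xa_j\overline{\varphi_n}\,dx$ for an atomic decomposition $f=\sum_j\lambda_ja_j$ with atoms supported in $X$ (independent of the decomposition). *)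

(* Defs.v *)
From HB Require Import structures.
From mathcomp Require Import all_boot all_order all_algebra.
From mathcomp Require Import all_classical all_reals all_analysis.
From mathcomp Require Import measurable_realfun.
From mathcomp Require Import complex.

Set Implicit Arguments.
Unset Strict Implicit.
Unset Printing Implicit Defensive.

Import Order.TTheory GRing.Theory Num.Theory.
Import numFieldNormedType.Exports.

Local Open Scope classical_set_scope.
Local Open Scope ring_scope.

Definition rV_display : measure_display.
Proof. exact: default_measure_display. Qed.

(* The product (Borel) sigma-algebra, generated by the coordinates; the     *)
(* counterpart for row vectors of the library instance on tuples.           *)
Section measurable_rV.
Variables (R : realType) (d : nat).

Let coor (i : 'I_d) (x : 'rV[R]_d) : measurableTypeR R := x ord0 i.

Definition rV_measurable : set (set 'rV[R]_d) := g_sigma_preimage coor.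

Let rV_set0 : rV_measurable set0.
Proof. exact: sigma_algebra0. Qed.

Let rV_setC A : rV_measurable A -> rV_measurable (~` A).
Proof. exact: sigma_algebraC. Qed.

Let rV_bigcup (F : _^nat) : (forall i, rV_measurable (F i)) ->
  rV_measurable (\bigcup_i (F i)).
Proof. exact: sigma_algebra_bigcup. Qed.

HB.instance Definition _ := @isMeasurable.Build rV_display 'rV[R]_d
  rV_measurable rV_set0 rV_setC rV_bigcup.

Lemma measurable_coor (i : 'I_d) :
  measurable_fun [set: 'rV[R]_d] (fun x : 'rV[R]_d => x ord0 i).
Proof.
move=> _ Y mY; rewrite setTI; apply: sub_sigma_algebra => /=.
rewrite -bigcup_seq/=; exists i => /=; first by rewrite mem_index_enum.
by exists Y => //; rewrite setTI.
Qed.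

Lemma measurable_fun_rVP d' (T : measurableType d') (f : T -> 'rV[R]_d) :
  (forall i, measurable_fun [set: T] (fun t => f t ord0 i)) ->
  measurable_fun [set: T] f.
Proof.
move=> mf _ A; rewrite setTI /measurable /= /rV_measurable.
suff: rV_measurable `<=` [set B | measurable (f @^-1` B)] by apply.
apply: smallest_sub.
  split => /=.
  - by rewrite preimage_set0.
  - by move=> B mB; rewrite setTD preimage_setC; exact: measurableC.
  - by move=> F mF; rewrite preimage_bigcup; exact: bigcup_measurable.
rewrite -bigcup_seq/=; apply: bigcup_sub => i _ _ [C mC <-] /=.
have := mf i measurableT C mC; rewrite !setTI.
by rewrite /preimage.
Qed.

End measurable_rV.

Section rV_cons.
Variables (R : realType) (n : nat).

Definition rV_cons (z : measurableTypeR R * 'rV[R]_n) : 'rV[R]_n.+1 :=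
  row_mx (const_mx z.1 : 'rV[R]_1) z.2.

Definition rV_uncons (x : 'rV[R]_n.+1) : measurableTypeR R * 'rV[R]_n :=
  (x ord0 ord0, rsubmx (x : 'rV[R]_(1 + n))).

Lemma rV_consK : cancel rV_cons rV_uncons.
Proof.
move=> [t x]; rewrite /rV_uncons /rV_cons /= row_mxKr; congr pair.
by rewrite mxE; case: fintype.splitP => // j _; rewrite mxE.
Qed.

Lemma rV_unconsK : cancel rV_uncons rV_cons.
Proof.
move=> x; apply/rowP => i; rewrite !mxE.
case: fintype.splitP => j ij; rewrite !mxE; congr (x _ _); apply: val_inj.
  by rewrite /= ij (ord1 j).
by rewrite /= ij.
Qed.

Lemma measurable_rV_cons : measurable_fun setT rV_cons.
Proof.
apply: measurable_fun_rVP => i; rewrite /rV_cons.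
under eq_fun do rewrite mxE.
case: fintype.split => j.
- by under eq_fun do rewrite mxE; exact: measurable_fst.
- exact: (measurableT_comp (measurable_coor _) measurable_snd).
Qed.

Lemma measurable_rV_uncons : measurable_fun setT rV_uncons.
Proof.
apply: measurable_fun_pair; first exact: measurable_coor.
apply: measurable_fun_rVP => i.
under eq_fun do rewrite mxE.
exact: measurable_coor.
Qed.

End rV_cons.


Section rV_cons_measure.
Local Open Scope ereal_scope.
Variables (R : realType) (n : nat).
Variable mu : {sigma_finite_measure set 'rV[R]_n -> \bar R}.

Definition rV_cons_measure : set 'rV[R]_n.+1 -> \bar R :=
  pushforward (@lebesgue_measure R \x mu) (@rV_cons R n).

Let lam : {measure set 'rV[R]_n.+1 -> \bar R} :=
  measure_function_pushforward__canonical__measure_function_Measure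
    (@lebesgue_measure R \x mu) (@measurable_rV_cons R n).

HB.instance Definition _ := isMeasure.Build _ _ _ rV_cons_measure
  (measure0 lam) (measure_ge0 lam) (@measure_semi_sigma_additive _ _ _ lam).

Let sigma_finite_rV_cons_measure : sigma_finite setT rV_cons_measure.
Proof.
have /sigma_finiteP[F [TF ndF Foo]] := sigma_finiteT (@lebesgue_measure R).
have /sigma_finiteP[G [TG ndG Goo]] := sigma_finiteT mu.
exists (fun k => @rV_uncons R n @^-1` (F k `*` G k)).
  rewrite -preimage_bigcup -(preimage_setT (@rV_uncons R n)) -setXTT TF TG.
  congr (_ @^-1` _); rewrite predeqE => -[x y]; split.
    move=> [/= [k _ Fkx] [l _ Gly]]; exists (maxn k l) => //; split.
    - by move: x Fkx; exact/subsetPset/ndF/leq_maxl.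
    - by move: y Gly; exact/subsetPset/ndG/leq_maxr.
  by move=> [k _ []/= ? ?]; split; exists k.
move=> k; have [mF Fk] := Foo k; have [mG Gk] := Goo k; split.
  rewrite -[X in measurable X]setTI.
  by apply: measurable_rV_uncons => //; exact: measurableX.
rewrite /rV_cons_measure /pushforward -comp_preimage.
rewrite (_ : _ \o _ = idfun); last first.
  by apply/funext => z /=; rewrite rV_consK.
by rewrite preimage_id product_measure1E// lte_mul_pinfty// ge0_fin_numE.
Qed.

HB.instance Definition _ := Measure_isSigmaFinite.Build _ _ _ rV_cons_measure
  sigma_finite_rV_cons_measure.

End rV_cons_measure.

(* Lebesgue measure on R^d, by R^(n+1) = R x R^n and product measures.      *)
Fixpoint lebesgue_rV (R : realType) (d : nat) :
    {sigma_finite_measure set 'rV[R]_d -> \bar R} :=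
  match d with
  | 0 => dirac (0 : 'rV[R]_0)
  | n.+1 => rV_cons_measure (lebesgue_rV R n)
  end.

Section euclidean.
Context {R : realType} {d : nat}.
Local Notation E := 'rV[R]_d.

(* The library norm on row vectors is the sup norm, hence this definition.  *)
Definition enorm (x : E) : R := Num.sqrt (\sum_(i < d) x ord0 i ^+ 2).

Definition edot (x y : E) : R := \sum_(i < d) x ord0 i * y ord0 i.

Definition eball (c : E) (r : R) : set E := [set x | enorm (x - c) < r].

(* Near each boundary point X is, for some unit direction v, the set of     *)
(* points above a Lipschitz graph over the hyperplane orthogonal to v. Only *)
(* the values of psi on that hyperplane matter, where a Lipschitz function  *)
(* is the restriction of its composition with the orthogonal projection.    *)
Definition lipschitz_boundary (X : set E) : Prop :=
  forall x0 : E, (closure X `\` interior X) x0 ->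
  exists (v : E) (psi : E -> R) (L e : R),
    [/\ enorm v = 1, 0 < e,
        (forall y z, `|psi y - psi z| <= L * enorm (y - z)) &
        forall x, eball x0 e x ->
          (X x <-> psi (x - edot x v *: v) < edot x v)].

Definition convex_lipschitz_domain (X : set E) : Prop :=
  [/\ open X, connected X, convex_set X & lipschitz_boundary X].

End euclidean.

Section multiindex.
Context {R : realType} {d : nat}.
Local Notation E := 'rV[R]_d.
Local Notation idx := {ffun 'I_d -> nat}.

Definition mdeg (n : idx) : nat := (\sum_(i < d) n i)%N.

Definition mfact (n : idx) : nat := (\prod_(i < d) (n i)`!)%N.

Definition monomial (n : idx) (x : E) : R := \prod_(i < d) x ord0 i ^+ n i.

(* The sum of F n over all multi-indices with |n| <= k; all components of   *)
(* such an n are at most k.                                                 *)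
Definition midx_sum {V : nmodType} (k : nat) (F : idx -> V) : V :=
  \sum_(n : {ffun 'I_d -> 'I_k.+1} | (\sum_(i < d) n i <= k)%N)
    F [ffun i => n i : nat].

Definition unit_vec (i : 'I_d) : E := delta_mx ord0 i.

Definition mderive (n : idx) (f : E -> R) : E -> R :=
  foldr (fun i g => iter (n i) (fun h x => 'D_(unit_vec i) h x) g) f
    (enum 'I_d).

Fixpoint Cn (k : nat) (U : set E) (f : E -> R) : Prop :=
  (forall x, U x -> {for x, continuous f}) /\
  if k is k'.+1 then
    forall i : 'I_d, (forall x, U x -> derivable f x (unit_vec i)) /\
      Cn k' U (fun x => 'D_(unit_vec i) f x)
  else True.

Definition cmderive (n : idx) (f : E -> R[i]) (x : E) : R[i] :=
  Complex (mderive n (fun y => complex.Re (f y)) x) (mderive n (fun y => complex.Im (f y)) x).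

Definition cCn (k : nat) (U : set E) (f : E -> R[i]) : Prop :=
  Cn k U (fun x => complex.Re (f x)) /\ Cn k U (fun x => complex.Im (f x)).

Definition smooth (f : E -> R[i]) : Prop := forall k, cCn k setT f.

End multiindex.

Section complex_integration.
Context {R : realType} {d : nat}.
Local Notation E := 'rV[R]_d.
Local Notation leb := (lebesgue_rV R d).

Definition ccvg (u : nat -> R[i]) (z : R[i]) : Prop :=
  (fun N => Normc.normc (u N - z)) @ \oo --> (0 : R).

Definition cmeasurable (D : set E) (f : E -> R[i]) : Prop :=
  measurable_fun D (fun x => complex.Re (f x)) /\ measurable_fun D (fun x => complex.Im (f x)).

Definition cintegrable (D : set E) (f : E -> R[i]) : Prop :=
  leb.-integrable D (fun x => (complex.Re (f x))%:E) /\
  leb.-integrable D (fun x => (complex.Im (f x))%:E).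

Definition cintegral (D : set E) (f : E -> R[i]) : R[i] :=
  Complex (\int[leb]_(x in D) complex.Re (f x)) (\int[leb]_(x in D) complex.Im (f x)).

Definition cLnorm (q : \bar R) (D : set E) (f : E -> R[i]) : \bar R :=
  'N[leb]_q [ (fun x => (Normc.normc (f x))%:E) \_ D ]%E.

Definition inL2 (X : set E) (f : E -> R[i]) : Prop :=
  cmeasurable X f /\ (cLnorm 2%:E X f < +oo)%E.

Definition L2dot (X : set E) (f g : E -> R[i]) : R[i] :=
  cintegral X (fun x => f x * conjc (g x)).

Definition L2cvg (X : set E) (u : nat -> E -> R[i]) (f : E -> R[i]) : Prop :=
  (fun N => cLnorm 2%:E X (fun x => f x - u N x)) @ \oo --> 0%E.

Record orthonormal_basis (X : set E)
    (phi : {ffun 'I_d -> nat} -> E -> R[i]) : Prop := {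
  onb_L2 : forall n, inL2 X (phi n) ;
  onb_orthonormal : forall n m, L2dot X (phi n) (phi m) = (n == m)%:R ;
  onb_complete : forall f, inL2 X f ->
    L2cvg X (fun N x => midx_sum N (fun n => L2dot X f (phi n) * phi n x)) f }.

(* K is the kernel of f |-> \sum_n r^|n| <f, phi_n> phi_n on L^2(X):        *)
(* the integrals of K x y * f x in x exist for almost every y in X and give *)
(* the sum of the series, which converges in L^2(X).                        *)
Definition is_integral_kernel (X : set E)
    (phi : {ffun 'I_d -> nat} -> E -> R[i]) (r : R) (K : E -> E -> R[i]) :=
  (measurable_fun (X `*` X) (fun z : E * E => complex.Re (K z.1 z.2)) /\
   measurable_fun (X `*` X) (fun z : E * E => complex.Im (K z.1 z.2))) /\
  forall f, inL2 X f ->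
    {ae leb, forall y, X y -> cintegrable X (fun x => K x y * f x)} /\
    L2cvg X
      (fun N y => midx_sum N
        (fun n => (r ^+ mdeg n)%:C%C * L2dot X f (phi n) * phi n y))
      (fun y => cintegral X (fun x => K x y * f x)).

End complex_integration.

Section lipschitz_spaces.
Context {R : realType} {d : nat}.
Local Notation E := 'rV[R]_d.
Local Notation leb := (lebesgue_rV R d).

Definition BMO (g : E -> R[i]) : Prop :=
  [/\ cmeasurable setT g,
      forall (c : E) (r : R), 0 < r -> cintegrable (eball c r) g &
      exists M : R, forall (c : E) (r : R), 0 < r ->
        let B := eball c r in
        let avg := ((fine (leb B))^-1)%:C%C * cintegral B g in
        (fine (leb B))^-1 * \int[leb]_(x in B) Normc.normc (g x - avg) <= M].

Definition bounded_cfun (g : E -> R[i]) : Prop :=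
  exists M : R, forall x, Normc.normc (g x) <= M.

Definition Lambda_frac (nu : R) (g : E -> R[i]) : Prop :=
  let k := Num.truncn nu in
  [/\ bounded_cfun g, cCn k setT g &
      exists M : R, forall n, mdeg n = k -> forall x h, h != 0 ->
        Normc.normc (cmderive n g (x + h) - cmderive n g x)
          / enorm h `^ (nu - k%:R) <= M].

Definition Lambda_int (nu : nat) (g : E -> R[i]) : Prop :=
  [/\ bounded_cfun g, cCn nu.-1 setT g &
      exists M : R, forall n, mdeg n = nu.-1 -> forall x h, h != 0 ->
        Normc.normc (cmderive n g (x + h) - cmderive n g x *+ 2
                     + cmderive n g (x - h)) / enorm h <= M].

Definition Lambda (nu : R) (g : E -> R[i]) : Prop :=
  if nu == 0 then BMO g
  else if nu == (Num.truncn nu)%:R then Lambda_int (Num.truncn nu) g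
  else Lambda_frac nu g.

Definition LambdaX (nu : R) (X : set E) (f : E -> R[i]) : Prop :=
  exists2 g, Lambda nu g & forall x, X x -> f x = g x.

End lipschitz_spaces.

Section hardy.
Context {R : realType} {d : nat}.
Local Notation E := 'rV[R]_d.
Local Notation leb := (lebesgue_rV R d).

Definition schwartz (f : E -> R[i]) : Prop :=
  smooth f /\ forall a b : {ffun 'I_d -> nat}, exists M : R, forall x,
    `|monomial a x| * Normc.normc (cmderive b f x) <= M.

(* A distribution is a functional defined on all functions, of which only   *)
(* the values on Schwartz functions are meaningful.                         *)
Record tempered (F : (E -> R[i]) -> R[i]) : Prop := {
  tempered_linear : forall (c : R[i]) f g, schwartz f -> schwartz g ->
    F (fun x => c * f x + g x) = c * F f + F g ;
  tempered_continuous : exists (C : R) (k : nat), forall f (M : R),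
    schwartz f ->
    (forall a b : {ffun 'I_d -> nat}, (mdeg a <= k)%N -> (mdeg b <= k)%N ->
      forall x, `|monomial a x| * Normc.normc (cmderive b f x) <= M) ->
    Normc.normc (F f) <= C * M }.

Definition test_function (U : set E) (f : E -> R[i]) : Prop :=
  smooth f /\ exists K : set E,
    [/\ compact K, K `<=` U & forall x, ~ K x -> f x = 0].

Definition dsupport (F : (E -> R[i]) -> R[i]) : set E :=
  [set x | forall U, open U -> U x -> exists2 f, test_function U f & F f <> 0].

Definition dilate (Phi : E -> R[i]) (t : R) (x : E) : R[i] :=
  ((t ^+ d)^-1)%:C%C * Phi (t^-1 *: x).

Definition radial_maximal (Phi : E -> R[i]) (F : (E -> R[i]) -> R[i])
    (x : E) : \bar R :=
  ereal_sup [set (Normc.normc (F (fun y => dilate Phi t (x - y))))%:E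
            | t in [set t : R | 0 < t]].

Definition Hp (Phi : E -> R[i]) (p : R) (F : (E -> R[i]) -> R[i]) : Prop :=
  [/\ tempered F, measurable_fun setT (radial_maximal Phi F) &
      ('N[leb]_(p%:E) [radial_maximal Phi F] < +oo)%E].

(* An element f = F|_X of H^p(X) is represented by F itself, a distribution *)
(* on R^d with support in the closure of X: for p < 1 the restriction of F  *)
(* to test functions of the open set X loses boundary terms, which the      *)
(* pairing with Lipschitz functions sees.                                   *)
Definition HpX (Phi : E -> R[i]) (p : R) (X : set E)
    (F : (E -> R[i]) -> R[i]) : Prop :=
  Hp Phi p F /\ dsupport F `<=` closure X.

(* For q = +oo the exponent (fine q)^-1 is 0, i.e., it stands for 1/q.      *)
Definition atom (p : R) (q : \bar R) (a : E -> R[i]) : Prop :=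
  cmeasurable setT a /\
  exists (c : E) (rad : R), 0 < rad /\
    let B := eball c rad in
    [/\ forall x, ~ B x -> a x = 0,
        (cLnorm q setT a <= leb B `^ ((fine q)^-1 - p^-1))%E &
        forall n : {ffun 'I_d -> nat},
          (mdeg n <= Num.truncn (d%:R * (p^-1 - 1)))%N ->
          cintegral B (fun x => a x * (monomial n x)%:C%C) = 0].

Definition lp_sum (p : R) (lambda : nat -> R[i]) : \bar R :=
  (\sum_(0 <= j <oo) (Normc.normc (lambda j) `^ p)%:E)%E.

(* F = \sum_j lambda_j a_j in the sense of tempered distributions.          *)
Record atomic_decomposition (p : R) (q : \bar R) (X : set E)
    (F : (E -> R[i]) -> R[i]) (lambda : nat -> R[i])
    (a : nat -> E -> R[i]) : Prop := {
  ad_atom : forall j, atom p q (a j) ;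
  ad_support : forall j x, ~ X x -> a j x = 0 ;
  ad_lp : (lp_sum p lambda < +oo)%E ;
  ad_sum : forall f, schwartz f ->
    ccvg (fun N => \sum_(j < N) lambda j * cintegral setT (fun x => a j x * f x))
         (F f) }.

Definition HpX_norm (p : R) (q : \bar R) (X : set E)
    (F : (E -> R[i]) -> R[i]) : \bar R :=
  ereal_inf [set z | exists lambda a,
    atomic_decomposition p q X F lambda a /\
    z = (lp_sum p lambda `^ p^-1)%E].

(* The common value of \sum_j lambda_j \int_X a_j \overline{phi} over all   *)
(* atomic decompositions of F: by the duality of H^p(X) and the Lipschitz   *)
(* space it exists and does not depend on the decomposition.                *)
Definition HpX_pairing (p : R) (q : \bar R) (X : set E)
    (F : (E -> R[i]) -> R[i]) (phi : E -> R[i]) : R[i] :=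
  xget 0 [set z | forall lambda a, atomic_decomposition p q X F lambda a ->
    ccvg (fun N => \sum_(j < N) lambda j * L2dot X (a j) phi) z].

End hardy.

(* Main.v *)
Require Import Defs.
From mathcomp Require Import all_boot all_order all_algebra.
From mathcomp Require Import all_classical all_reals all_analysis.
From mathcomp Require Import finmap measurable_realfun.
From mathcomp Require Import complex.
From mathcomp Require Import ring lra.

Set Implicit Arguments.
Unset Strict Implicit.
Unset Printing Implicit Defensive.

Import Order.TTheory GRing.Theory Num.Theory.
Import numFieldNormedType.Exports.

Local Open Scope classical_set_scope.
Local Open Scope ring_scope.

(** Fix an atom [a] of the ball [B] of radius [rho] and put [c_n = <a, phi_n>].
Two bounds on square sums of the [c_n] are available. Bessel's inequality gives
[sum |c_n|^2 <= 2 ||a||_2^2 <~ rho^(d - 2d/p)]. If [rho <= 1/4], the moment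
conditions allow us to subtract from [K r x y] its Taylor polynomial in [x] at a
point of [B], so that Cauchy-Schwarz and Tonelli bound [||R_r a||_2], hence
[sum r^(2|n|) |c_n|^2], by [||a||_1^2] times the assumed remainder estimate for
[k = P]. Taking [r = 1 - 1/M] with [M = 2^(k+1)], both bounds together say that
the square sum over [|n| < M] is at most
[C M^(2 kappa) min(u^a, u^(-a))^2], where [u = M^(2 gamma) rho] and
[kappa = (2 - p) d gamma / p]. On the block [M/2 <= |n|+1 < M], which has at most
[M^d] elements, the elementary inequality [c^s <= t^s + t^(s-2) c^2] with
[t = M^(kappa - d/2) min(u^a, u^(-a))] then bounds
[sum |c_n|^s / (|n|+1)^E] by [C min(u^a, u^(-a))^s], and these bounds sum over [k]
to a constant independent of [rho].

A general [f] is handled through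
[|sum_j mu_j x_j|^s <= sum_j mu_j^p x_j^s], valid when [sum_j mu_j^p <= 1].
For each atomic decomposition, the pairing [HpX_pairing] is either the limit of
the partial sums or the default value 0, so the duality theorem is not needed. *)

(** The two square-sum bounds meet at [u = 1], that is [rho = M^(-2 gamma)]. With
    [eta = d(1/p - 1/2)] one has [kappa = 2 gamma eta], so Bessel's bound [rho^(-2 eta)] is
    [M^(2 kappa) u^(-2 eta)]. In the remainder estimate [M^((d + 2P + 2 delta) gamma)] comes with
    [rho^(P + delta - nu)], where [nu = d(1/p - 1)]; the product is [M^kappa u^(P + delta - nu)],
    and [delta] has disappeared from the power of [M]. Hence any [a] with [0 < a <= eta] and
    [a <= P + delta - nu] for all [delta] serves. Such an [a] exists because [Delta] is finite and
    each [delta] is strictly above [nu - P]; with [a = 0] the block bounds would not sum uniformly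
    in [rho]. The technical obstacle is measurability: Tonelli's theorem is applied to a Taylor
    remainder whose coefficients are derivatives in [x], so their measurability in [y] has to be
    obtained from difference quotients taken inside [X]. Factors 2 are accepted freely in place of
    sharp norm identities and limits of norms. *)

(** * Sums of powers *)

(* The sum telescopes: [min(u, 1/u) <= C (f(theta u) - f(u))] for the bounded
   increasing function [f u = u / (1 + u)]. *)
Lemma sum_min_geometric (R : realFieldType) (theta x : R) (n : nat) :
  1 < theta -> 0 < x ->
  \sum_(k < n) Num.min (theta ^+ k * x) (theta ^+ k * x)^-1
    <= 2 * (1 + theta) / (theta - 1).
Proof.
move=> th1 x0; set C := 2 * _ / _.
pose f (u : R) := u / (1 + u).
have th0 : 0 < theta by apply: lt_trans th1.
have C0 : 0 < C by rewrite /C divr_gt0 ?mulr_gt0 ?subr_gt0 ?addr_gt0.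
have step u : 0 < u -> Num.min u u^-1 <= C * (f (theta * u) - f u).
  move=> u0; have tu0 : 0 < theta * u by rewrite mulr_gt0.
  have -> : C * (f (theta * u) - f u) =
      2 * (1 + theta) * u / ((1 + u) * (1 + theta * u)).
    by rewrite /C /f; field; rewrite !lt0r_neq0 ?subr_gt0 ?addr_gt0.
  have D0 : 0 < (1 + u) * (1 + theta * u) by rewrite mulr_gt0 ?addr_gt0.
  rewrite ler_pdivlMr //.
  have [u1|u1] := leP u 1.
    apply: (@le_trans _ _ (u * ((1 + u) * (1 + theta * u)))).
      by apply: ler_wpM2r; [exact: ltW|rewrite ge_min lexx].
    rewrite mulrC ler_wpM2r ?(ltW u0) // ler_pM ?(ltW u0) ?addr_ge0
      ?(ltW tu0) ?(ltW u0) //; first lra.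
    by rewrite lerD2l -[leRHS]mulr1 ler_wpM2l ?(ltW th0).
  apply: (@le_trans _ _ (u^-1 * ((1 + u) * (1 + theta * u)))).
    by apply: ler_wpM2r; [exact: ltW|rewrite ge_min lexx orbT].
  have -> : u^-1 * ((1 + u) * (1 + theta * u)) =
      (1 + u) * (1 + theta * u) / u by rewrite mulrC.
  rewrite ler_pdivrMr // -[_ * u * u]mulrA -expr2.
  have -> : 2 * (1 + theta) * u ^+ 2 = (2 * u) * ((1 + theta) * u) by ring.
  by rewrite ler_pM ?addr_ge0 ?(ltW tu0) ?(ltW u0) //; lra.
have main : \sum_(k < n) Num.min (theta ^+ k * x) (theta ^+ k * x)^-1
    <= C * (f (theta ^+ n * x) - f x).
  elim: n => [|n IH]; first by rewrite big_ord0 expr0 mul1r subrr mulr0.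
  rewrite big_ord_recr /=; apply: le_trans (lerD IH (step _ _)) _.
    by rewrite mulr_gt0 ?exprn_gt0.
  by rewrite -mulrDr mulrA -exprS [_ - _ + _]addrC addrA subrK.
apply: le_trans main _; rewrite -[leRHS]mulr1; apply: ler_wpM2l; first exact: ltW.
have fx : 0 <= f x by rewrite /f divr_ge0 ?addr_ge0 ?ltW.
have nx : 0 < theta ^+ n * x by rewrite mulr_gt0 ?exprn_gt0.
rewrite lerBlDr; apply: (@le_trans _ _ 1); last by rewrite lerDl.
by rewrite /f ler_pdivrMr ?addr_gt0 // mul1r lerDr.
Qed.

(** Each share [z / S] of a total [S] lies in [0, 1], hence is at most [(z / S)^s]; multiplying by
    [S^s] and adding the two shares gives the induction step. *)
Lemma powR_sum_le (R : realType) (I : Type) (r : seq I) (s : R) (x : I -> R) :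
  0 < s -> s <= 1 -> (forall i, 0 <= x i) ->
  (\sum_(i <- r) x i) `^ s <= \sum_(i <- r) x i `^ s.
Proof.
move=> s0 s1 x0; elim: r => [|i r IH].
  by rewrite !big_nil powR0 ?lt0r_neq0.
rewrite !big_cons; set y := \sum_(j <- r) x j in IH *.
have y0 : 0 <= y by rewrite sumr_ge0.
apply: le_trans (lerD (lexx _) IH).
have [S0|S0] := eqVneq (x i + y) 0.
  by rewrite S0 powR0 ?lt0r_neq0 // addr_ge0 ?powR_ge0.
have S1 : 0 < x i + y by rewrite lt_neqAle eq_sym S0 addr_ge0.
have frac z : 0 <= z -> z <= x i + y -> z / (x i + y) * (x i + y) `^ s <= z `^ s.
  move=> z0 zS; rewrite -{2}(divfK S0 z) powRM ?divr_ge0 // ?(ltW S1) //.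
  rewrite ler_wpM2r ?powR_ge0 //.
  have [->|zn0] := eqVneq z 0; first by rewrite mul0r powR_ge0.
  have q0 : 0 < z / (x i + y) by rewrite divr_gt0 // lt_neqAle eq_sym zn0.
  have q1 : z / (x i + y) <= 1 by rewrite ler_pdivrMr // mul1r.
  by rewrite -[leLHS]powRr1 ?(ltW q0) // ger_powR // q0.
apply: le_trans (lerD (frac _ (x0 i) _) (frac _ y0 _)); last 2 first.
- by rewrite lerDl.
- by rewrite lerDr.
by rewrite -mulrDl -mulrDl divff // mul1r.
Qed.

(** Jensen's inequality for weights of total mass at most 1. The constant term [- (s - 1) y^s] of
    the tangent is nonpositive, so missing mass does no harm. *)
Lemma powR_wsum_le (R : realType) (I : Type) (r : seq I) (s : R)
    (mu x : I -> R) :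
  1 <= s -> (forall i, 0 <= mu i) -> (forall i, 0 <= x i) ->
  \sum_(i <- r) mu i <= 1 ->
  (\sum_(i <- r) mu i * x i) `^ s <= \sum_(i <- r) mu i * x i `^ s.
Proof.
move=> s1 mu0 x0 mu1; have s0 : 0 < s by apply: lt_le_trans s1.
set y := \sum_(i <- r) _.
have y0 : 0 <= y by rewrite sumr_ge0 // => i _; rewrite mulr_ge0.
(* The tangent line of [x |-> x^s] at [y], from Young's inequality. *)
have tangent i : s * (y `^ (s - 1) * x i) - (s - 1) * y `^ s <= x i `^ s.
  move: s1; rewrite le_eqVlt => /predU1P[<-|s1].
    by rewrite subrr powRr0 !mul1r mul0r subr0 powRr1.
  have q0 : 0 < s / (s - 1) by rewrite divr_gt0 ?subr_gt0.
  have pq : s^-1 + (s / (s - 1))^-1 = 1.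
    by field; rewrite subr_eq0 gt_eqF ?lt0r_neq0.
  have := @conjugate_powR R (x i) (y `^ (s - 1)) s (s / (s - 1))
    (x0 i) (powR_ge0 _ _) s0 q0 pq.
  have sn0 : s - 1 != 0 by rewrite subr_eq0 gt_eqF.
  rewrite -powRrM [(s - 1) * (s / _)]mulrC divfK //.
  rewrite -(ler_pM2l s0) => H.
  rewrite [y `^ _ * _]mulrC lerBlDr; apply: le_trans H _.
  rewrite le_eqVlt; apply/orP; left; apply/eqP; field.
  by rewrite sn0 lt0r_neq0.
apply: (@le_trans _ _ (\sum_(i <- r)
    mu i * (s * (y `^ (s - 1) * x i) - (s - 1) * y `^ s))); last first.
  by apply: ler_sum => i _; rewrite ler_wpM2l.
under eq_bigr do rewrite mulrBr.
rewrite sumrB -mulr_suml.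
have -> : \sum_(i <- r) mu i * (s * (y `^ (s - 1) * x i)) = s * y `^ s.
  rewrite (_ : y `^ s = y `^ (s - 1) * y).
    rewrite /y !mulr_sumr; apply: eq_bigr => i _; ring.
  have [->|yn0] := eqVneq y 0; first by rewrite mulr0 powR0 ?lt0r_neq0.
  by rewrite -{3}(powRr1 y0) -powRD ?yn0 ?implybT // subrK.
have : \sum_(i <- r) mu i * ((s - 1) * y `^ s) <= 1 * ((s - 1) * y `^ s).
  rewrite -mulr_suml ler_wpM2r // mulr_ge0 ?powR_ge0 ?subr_ge0 //.
rewrite -mulr_suml.
lra.
Qed.

(** Subadditivity for [s <= 1], convexity with weights [mu_i] for [s > 1]. As [mu_i <= 1], lowering
    its exponent from [s] or from 1 to [p] only enlarges it. *)
Lemma powR_atomic_sum_le (R : realType) (I : Type) (r : seq I) (p s : R)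
    (mu x : I -> R) :
  0 < p -> p <= 1 -> p <= s ->
  (forall i, 0 <= mu i) -> (forall i, mu i <= 1) -> (forall i, 0 <= x i) ->
  \sum_(i <- r) mu i `^ p <= 1 ->
  (\sum_(i <- r) mu i * x i) `^ s <= \sum_(i <- r) mu i `^ p * x i `^ s.
Proof.
move=> p0 p1 ps mu0 mu1 x0 sum1.
have s0 : 0 < s by apply: lt_le_trans ps.
have mup t i : p <= t -> mu i `^ t <= mu i `^ p.
  move=> pt; have t0 : 0 < t by apply: lt_le_trans pt.
  have [->|n0] := eqVneq (mu i) 0; first by rewrite !powR0 ?lt0r_neq0.
  by rewrite ger_powR // lt_neqAle eq_sym n0 mu0 mu1.
have [s1|s1] := leP s 1.
  apply: le_trans (powR_sum_le _ s0 s1 _) _.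
    by move=> i; rewrite mulr_ge0.
  apply: ler_sum => i _; rewrite powRM // ler_wpM2r ?powR_ge0 //; exact: mup.
have mule i : mu i <= mu i `^ p by rewrite -{1}(powRr1 (mu0 i)) mup.
apply: le_trans (powR_wsum_le (ltW s1) mu0 x0 _) _.
  by apply: le_trans sum1; apply: ler_sum.
by apply: ler_sum => i _; rewrite ler_wpM2r ?powR_ge0.
Qed.

(** * Multi-indices and dyadic blocks *)

Lemma ler_sum_uniq (R : numDomainType) (I : eqType) (r1 r2 : seq I) (F : I -> R) :
  uniq r1 -> uniq r2 -> {subset r1 <= r2} -> (forall i, 0 <= F i) ->
  \sum_(i <- r1) F i <= \sum_(i <- r2) F i.
Proof.
move=> u1 u2 sub F0.
rewrite [leRHS](perm_big (r1 ++ [seq i <- r2 | i \notin r1])) /=; last first.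
  apply: uniq_perm => //.
    rewrite cat_uniq u1 filter_uniq // andbT.
    by apply/hasPn => i; rewrite mem_filter => /andP[].
  move=> i; rewrite mem_cat mem_filter.
  by have [/sub ->|] := boolP (i \in r1).
by rewrite big_cat lerDl sumr_ge0.
Qed.

(** The index type of [midx_sum] changes with the degree bound; duplicate-free lists over one type
    make sums for different bounds comparable. *)
Definition box (d N : nat) : seq {ffun 'I_d -> nat} :=
  [seq [ffun i => n i : nat] | n : {ffun 'I_d -> 'I_N.+1} <-
     enum [pred n : {ffun 'I_d -> 'I_N.+1} | (\sum_(i < d) n i <= N)%N]].

Lemma midx_sum_box (V : nmodType) (d N : nat) (F : {ffun 'I_d -> nat} -> V) :
  midx_sum N F = \sum_(n <- box d N) F n.
Proof. by rewrite /box big_map big_enum. Qed.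

Lemma box_uniq (d N : nat) : uniq (box d N).
Proof.
rewrite map_inj_uniq ?enum_uniq // => n m /ffunP nm.
by apply/ffunP => i; apply: val_inj; have := nm i; rewrite !ffunE.
Qed.

Lemma mem_box (d N : nat) (n : {ffun 'I_d -> nat}) :
  (n \in box d N) = (mdeg n <= N)%N.
Proof.
apply/mapP/idP => [[m]|nN].
  rewrite mem_enum inE => mN ->; rewrite /mdeg.
  by under eq_bigr do rewrite ffunE.
have leN i : (n i < N.+1)%N.
  by rewrite ltnS (leq_trans _ nN) // /mdeg (bigD1 i) //= leq_addr.
exists [ffun i => Ordinal (leN i)]; last by apply/ffunP => i; rewrite !ffunE.
rewrite mem_enum inE; apply: leq_trans nN.
by apply: leq_sum => i _; rewrite ffunE.
Qed.

Lemma size_box (d N : nat) : (size (box d N) <= N.+1 ^ d)%N.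
Proof.
rewrite size_map -cardE (leq_trans (max_card _)) //.
by rewrite card_ffun !card_ord.
Qed.

(** With a threshold [t] chosen for each block, this passes from squares to powers [s] in place of
    Hoelder's inequality. For [c > t] write [c^s = c^(s-2) c^2] and use [s - 2 <= 0]. *)
Lemma powR_le_weighted (R : realType) (c t s : R) :
  0 <= c -> 0 < t -> 0 <= s -> s <= 2 ->
  c `^ s <= t `^ s + t `^ (s - 2) * c ^+ 2.
Proof.
move=> c0 t0 s0 s2; have [ct|tc] := leP c t.
  apply: (@le_trans _ _ (t `^ s)); first by apply: ge0_ler_powR; rewrite ?nnegrE ?(ltW t0).
  by rewrite lerDl mulr_ge0 ?powR_ge0 ?sqr_ge0.
have c1 : 0 < c by apply: lt_trans tc.
apply: (@le_trans _ _ (t `^ (s - 2) * c ^+ 2)); last by rewrite lerDr powR_ge0.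
have -> : c `^ s = c `^ (s - 2) * c ^+ 2.
  by rewrite -powR_mulrn // -powRD ?subrK // lt0r_neq0 ?implybT.
have e x : x `^ (s - 2) = (x `^ (2 - s))^-1 by rewrite -powRN opprB.
rewrite ler_wpM2r ?sqr_ge0 // !e lef_pV2 ?posrE ?powR_gt0 //.
by apply: ge0_ler_powR; rewrite ?nnegrE ?(ltW t0) ?(ltW tc) ?subr_ge0 ?(ltW c1).
Qed.

(** The threshold [t] satisfies [t^2 M^d = M^(2 kappa) m^2]. This balances at most [M^d] copies of
    [t^s] against [t^(s-2)] times the square sum. Up to [C0] both are [M^d t^s = M^E m^s], an
    identity that is the origin of [E]. *)
Lemma dyadic_block_le (R : realType) (d k : nat) (c : {ffun 'I_d -> nat} -> R)
    (s kappa m C0 : R) :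
  let M := 2 ^+ k.+1 in let E := kappa * s + (2 - s) * d%:R / 2 in
  0 <= s -> s <= 2 -> 0 <= kappa -> 0 < m -> (forall n, 0 <= c n) ->
  \sum_(n <- box d (2 ^ k.+1).-1) c n ^+ 2 <= C0 * M `^ (2 * kappa) * m ^+ 2 ->
  \sum_(n <- box d (2 ^ k.+1).-1 | (2 ^ k <= (mdeg n).+1)%N)
     c n `^ s / (mdeg n).+1%:R `^ E <= 2 `^ E * (1 + C0) * m `^ s.
Proof.
move=> M E s0 s2 k0 m0 c0 sumc.
have M0 : 0 < M by rewrite exprn_gt0.
have E0 : 0 <= E by rewrite addr_ge0 ?mulr_ge0 ?subr_ge0 ?invr_ge0.
pose t := M `^ (kappa - d%:R / 2) * m.
have t0 : 0 < t by rewrite mulr_gt0 ?powR_gt0.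
(* On the block the weight is at least [Q^E] with [Q = M / 2]; this costs the factor [2^E]. *)
set Q := (2 ^ k)%:R : R.
have Q0 : 0 < Q by rewrite ltr0n expn_gt0.
have QM : Q `^ E = M `^ E / 2 `^ E.
  have -> : M = 2 * Q by rewrite /M /Q natrX exprS.
  by rewrite powRM ?(ltW Q0) // mulrAC divff ?mul1r // lt0r_neq0 ?powR_gt0.
apply: (@le_trans _ _ (\sum_(n <- box d (2 ^ k.+1).-1) c n `^ s / Q `^ E)).
  rewrite big_mkcond; apply: ler_sum => n _; case: ifP => kn; last first.
    by rewrite divr_ge0 ?powR_ge0.
  rewrite ler_wpM2l ?powR_ge0 // lef_pV2 ?posrE ?powR_gt0 //.
  apply: ge0_ler_powR; rewrite ?nnegrE ?(ltW Q0) ?ler0n //.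
  by rewrite ler_nat.
rewrite -mulr_suml QM invf_div mulrCA -[leRHS]mulrA.
rewrite ler_wpM2l ?powR_ge0 //.
rewrite ler_pdivrMr ?powR_gt0 //.
apply: (@le_trans _ _ (\sum_(n <- box d (2 ^ k.+1).-1)
    (t `^ s + t `^ (s - 2) * c n ^+ 2))).
  by apply: ler_sum => n _; apply: powR_le_weighted.
rewrite big_split /= -mulr_sumr big_const_seq count_predT iter_addr_0.
have tsM : t `^ s * M ^+ d = M `^ E * m `^ s.
  rewrite /t powRM ?powR_ge0 ?(ltW m0) // -powRrM -powR_mulrn ?(ltW M0) //.
  rewrite mulrAC -powRD ?(lt0r_neq0 M0) ?implybT //; congr (_ `^ _ * _).
  by rewrite /E; field.
have -> : (1 + C0) * m `^ s * M `^ E = t `^ s * M ^+ d + C0 * (t `^ s * M ^+ d).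
  by rewrite tsM; ring.
apply: lerD.
  rewrite -mulr_natr ler_wpM2l ?powR_ge0 //.
  rewrite /M -natrX -natrX ler_nat; apply: leq_trans (size_box _ _) _.
  by rewrite prednK // expn_gt0.
apply: (@le_trans _ _ (t `^ (s - 2) * (C0 * M `^ (2 * kappa) * m ^+ 2))).
  by rewrite ler_wpM2l ?powR_ge0.
rewrite powRB ?(lt0r_neq0 t0) ?implybT //.
rewrite le_eqVlt; apply/orP; left; apply/eqP.
rewrite powR_mulrn ?(ltW t0) // {2}/t exprMn.
have -> : (M `^ (kappa - d%:R / 2)) ^+ 2 = M `^ (2 * kappa) / M ^+ d.
  rewrite -powR_mulrn ?powR_ge0 // -powRrM -powR_mulrn ?(ltW M0) // -powRB.
    by congr (_ `^ _); field.
  by rewrite (lt0r_neq0 M0) implybT.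
by field; rewrite ?lt0r_neq0 ?powR_gt0 ?exprn_gt0.
Qed.

Lemma min_inv_powR (R : realType) (u a : R) :
  0 < u -> 0 <= a -> Num.min u u^-1 `^ a = Num.min (u `^ a) (u `^ a)^-1.
Proof.
move=> u0 a0.
have inv : (u `^ a)^-1 = u^-1 `^ a by rewrite -(powR_inv1 (ltW u0)) -powRrM mulN1r powRN.
rewrite inv; have [uV|Vu] := leP u u^-1.
  rewrite min_l //; apply: ge0_ler_powR; rewrite ?nnegrE ?invr_ge0 ?(ltW u0) //.
rewrite min_r //; apply: ge0_ler_powR; rewrite ?nnegrE ?invr_ge0 ?(ltW u0) //.
exact: ltW.
Qed.

(** When [k] grows by one, [M] doubles and [u^(a s)] is multiplied by [theta > 1]. The block bounds
    form a two-sided geometric sum, bounded whatever its starting value [x], hence whatever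
    [rho]. *)
Lemma dyadic_sum_le (R : realType) (d : nat) (c : {ffun 'I_d -> nat} -> R)
    (s kappa gamma a rho C0 : R) (N : nat) :
  let E := kappa * s + (2 - s) * d%:R / 2 in
  let theta := 2 `^ (2 * gamma * a * s) in
  0 < s -> s <= 2 -> 0 <= kappa -> 0 < gamma -> 0 < a -> 0 < rho -> 0 <= C0 ->
  (forall n, 0 <= c n) ->
  (forall k, let M : R := 2 ^+ k.+1 in
    let u := M `^ (2 * gamma) * rho in
    \sum_(n <- box d (2 ^ k.+1).-1) c n ^+ 2
      <= C0 * M `^ (2 * kappa) * (Num.min u u^-1 `^ a) ^+ 2) ->
  \sum_(n <- box d N) c n `^ s / (mdeg n).+1%:R `^ E
    <= 2 `^ E * (1 + C0) * (2 * (1 + theta) / (theta - 1)).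
Proof.
move=> E theta s0 s2 k0 g0 a0 r0 C00 c0 sumc.
have theta1 : 1 < theta.
  have : 1 `^ (2 * gamma * a * s) < theta.
    by apply: gt0_ltr_powR; rewrite ?nnegrE ?ltr1n ?mulr_gt0.
  by rewrite powR1.
pose F (n : {ffun 'I_d -> nat}) := c n `^ s / (mdeg n).+1%:R `^ E.
rewrite (eq_bigr F) //.
pose x := (2 `^ (2 * gamma) * rho) `^ (a * s).
have x0 : 0 < x by rewrite powR_gt0 // mulr_gt0 ?powR_gt0.
have F0 n : 0 <= F n by rewrite divr_ge0 ?powR_ge0.
(* Blocks are indexed by the integer part of [log2 (|n| + 1)]; then [n] lies in the box on which
   [sumc] controls the squares. *)
have tlP (n : {ffun 'I_d -> nat}) k : trunc_log 2 (mdeg n).+1 = k ->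
    (2 ^ k <= (mdeg n).+1)%N /\ (mdeg n <= (2 ^ k.+1).-1)%N.
  move=> <-; split; first exact: trunc_logP.
  rewrite -ltnS prednK ?expn_gt0 //; apply: ltn_trans (ltnSn _) _.
  exact: trunc_log_ltn.
apply: (@le_trans _ _ (\sum_(k < N.+1)
    \sum_(n <- box d (2 ^ k.+1).-1 | (2 ^ k <= (mdeg n).+1)%N) F n)).
  apply: (@le_trans _ _ (\sum_(k < N.+1)
      \sum_(n <- box d N | trunc_log 2 (mdeg n).+1 == k) F n)).
    under [leRHS]eq_bigr do rewrite big_mkcond.
    rewrite exchange_big /= big_seq [leRHS]big_seq; apply: ler_sum => n.
    rewrite mem_box => nN.
    have tN : (trunc_log 2 (mdeg n).+1 < N.+1)%N.
      rewrite ltnS; apply: leq_trans nN.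
      have := @trunc_logP 2 (mdeg n).+1 isT isT.
      by move/(leq_trans (ltn_expl _ (isT : 1 < 2)%N)); rewrite ltnS.
    rewrite (bigD1 (Ordinal tN)) //= eqxx lerDl sumr_ge0 // => i _.
    by case: ifP.
  apply: ler_sum => k _; rewrite -big_filter -[leRHS]big_filter.
  apply: ler_sum_uniq => //; rewrite ?filter_uniq ?box_uniq //.
  move=> n; rewrite !mem_filter mem_box => /andP[/eqP/tlP[-> nk] _].
  by rewrite mem_box.
apply: (@le_trans _ _ (\sum_(k < N.+1) 2 `^ E * (1 + C0) *
    Num.min (theta ^+ k * x) (theta ^+ k * x)^-1)); last first.
  rewrite -mulr_sumr ler_wpM2l ?sum_min_geometric //.
  by rewrite mulr_ge0 ?powR_ge0 ?addr_ge0.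
apply: ler_sum => k _.
pose u : R := (2 ^+ k.+1) `^ (2 * gamma) * rho.
have u0 : 0 < u by rewrite mulr_gt0 ?powR_gt0 ?exprn_gt0.
have e : theta ^+ k * x = u `^ (a * s).
  rewrite /x /u exprS [(2 * 2 ^+ k) `^ _]powRM ?exprn_ge0 //.
  rewrite -[_ * (2 ^+ k) `^ _ * rho]mulrA [_ `^ _ * (_ * rho)]mulrCA.
  rewrite [RHS]powRM ?powR_ge0 ?mulr_ge0 ?powR_ge0 ?(ltW r0) //; congr (_ * _).
  have -> : theta ^+ k = theta `^ k%:R by rewrite powR_mulrn ?powR_ge0.
  have -> : 2 ^+ k = 2 `^ k%:R :> R by rewrite powR_mulrn.
  rewrite /theta -!powRrM.
  by congr (_ `^ _); ring.
rewrite e -min_inv_powR ?mulr_ge0 ?(ltW a0) ?(ltW s0) // powRrM.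
have m0 : 0 < Num.min u u^-1 `^ a by rewrite powR_gt0 // lt_min u0 invr_gt0.
have := dyadic_block_le (k := k) (C0 := C0) (ltW s0) s2 k0 m0 c0.
by apply; exact: sumc.
Qed.

(** * Balls and Lebesgue measure *)

Lemma rV_ballP (R : realType) (d : nat) (c x : 'rV[R]_d) (r : R) :
  0 < r -> (ball c r x <-> forall i, ball (c ord0 i) r (x ord0 i)).
Proof.
by move=> r0; split=> [[_ b] i|b]; last split=> // i j; rewrite ?(ord1 i); exact: b.
Qed.

Lemma measurable_rV_ball (R : realType) (d : nat) (c : 'rV[R]_d) (r : R) :
  0 < r -> measurable (ball c r).
Proof.
move=> r0; have -> : ball c r = \bigcap_(i in [set: 'I_d])
    ((fun x : 'rV[R]_d => x ord0 i) @^-1` ball (c ord0 i) r).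
  apply/seteqP; split=> x; first by move/(rV_ballP _ _ r0)=> b i _; exact: b.
  by move=> b; apply/(rV_ballP _ _ r0) => i; exact: b.
apply: fin_bigcap_measurable => [|i _]; first exact: finite_finset.
rewrite -[_ @^-1` _]setTI; apply: measurable_coor => //.
exact: measurable_ball.
Qed.

(** The sigma-algebra is generated by the coordinates, so countability enters: the balls with
    rational centre and radius [1/(k+1)] that are contained in [X] cover it. *)
Lemma measurable_rV_open (R : realType) (d : nat) (X : set 'rV[R]_d) :
  open X -> measurable X.
Proof.
move=> oX.
pose q (i : {ffun 'I_d -> rat} * nat) : 'rV[R]_d := \row_j ratr (i.1 j).
pose F i := if `[< ball (q i) i.2.+1%:R^-1 `<=` X >]
            then ball (q i) i.2.+1%:R^-1 else set0.
have -> : X = \bigcup_i F i.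
  apply/seteqP; split=> [x Xx|x [i _]]; last first.
    by rewrite /F; case: ifPn => // /asboolP; apply.
  have [e /= e0 eX] : nbhs_ball x X by apply/nbhs_ballP; exact: open_nbhs_nbhs.
  (* Below [e / 2], so that a ball of this radius containing [x] stays within distance [e] of [x],
     hence in [X]. *)
  have [k ke] : exists k : nat, k.+1%:R^-1 < e / 2.
    have e2 : 0 < e / 2 by rewrite divr_gt0.
    have [k _ /(_ k (leqnn k)) ke] := near_infty_natSinv_lt (PosNum e2).
    by exists k.
  have k0 : 0 < k.+1%:R^-1 :> R by rewrite invr_gt0.
  have /choice[f fP] : forall j : 'I_d, exists y : rat,
      ball (x ord0 j) k.+1%:R^-1 (ratr y : R).
    move=> j.
    have := @rat_in_itvoo R (x ord0 j - k.+1%:R^-1) (x ord0 j + k.+1%:R^-1).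
    move=> /(_ _)[|y]; first by rewrite ltrD2l gt0_cp.
    by rewrite in_itv /= => /andP[h1 h2]; exists y; rewrite /ball /= ltr_distlC h1 h2.
  exists ([ffun j => f j], k) => //.
  have xq : ball (q ([ffun j => f j], k)) k.+1%:R^-1 x.
    by apply/rV_ballP => // j; rewrite mxE ffunE; apply: ball_sym; exact: fP.
  rewrite /F; case: ifPn => // /asboolPn[] y /= qy.
  apply: eX; apply: (@le_ball _ _ _ (k.+1%:R^-1 + k.+1%:R^-1)).
    by rewrite [leRHS](splitr e) lerD ?ltW.
  apply: ball_triangle qy; exact: ball_sym.
apply: countable_bigcupT_measurable => // i; rewrite /F.
by case: ifP => _; [apply: measurable_rV_ball; rewrite invr_gt0|exact: measurable0].
Qed.

(** Balls of the sup norm are cubes, on which the recursive product measure can be computed. *)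
Lemma lebesgue_rV_ball (R : realType) (d : nat) (c : 'rV[R]_d) (r : R) :
  0 < r -> lebesgue_rV R d (ball c r) = ((r *+ 2) ^+ d)%:E.
Proof.
move=> r0; elim: d c => [|n IH] c.
  by rewrite /= diracE mem_set //; apply/rV_ballP => //; case.
have -> : lebesgue_rV R n.+1 (ball c r) =
  ((@lebesgue_measure R \x lebesgue_rV R n) (@rV_cons R n @^-1` ball c r))%E by [].
have -> : @rV_cons R n @^-1` ball c r =
    ball (c ord0 ord0) r `*` ball (rsubmx (c : 'rV_(1 + n))) r.
  apply/seteqP; split=> -[t x] /=; case: (rV_consK (t, x));
      move: (rV_cons (t, x)) => y <- <-.
    move/(rV_ballP _ _ r0) => b; split; first exact: b.
    by apply/rV_ballP => // i; have := b (rshift 1 i); rewrite !mxE.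
  move=> -[b1 /(rV_ballP _ _ r0) b2].
  apply/rV_ballP => // i; rewrite -(splitK (i : 'I_(1 + n))).
  case: fintype.split => j /=; last by have := b2 j; rewrite !mxE.
  by rewrite (_ : lshift n j = ord0) //; apply: val_inj; rewrite /= (ord1 j).
rewrite product_measure1E; [|exact: measurable_ball|exact: measurable_rV_ball].
rewrite IH exprS EFinM; congr (_ * _)%E.
exact: lebesgue_measure_ball (ltW r0).
Qed.

Section enorm_lemmas.
Variables (R : realType) (d : nat).
Implicit Types x y c : 'rV[R]_d.

Lemma enorm_ge0 x : 0 <= enorm x. Proof. exact: sqrtr_ge0. Qed.

Lemma enorm_sqr x : enorm x ^+ 2 = \sum_(i < d) x ord0 i ^+ 2.
Proof. by rewrite /enorm sqr_sqrtr // sumr_ge0 // => i _; rewrite sqr_ge0. Qed.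

Lemma coor_le_enorm x i : `|x ord0 i| <= enorm x.
Proof.
rewrite -(@ler_pXn2r _ 2) ?nnegrE ?enorm_ge0 // real_normK ?num_real //.
rewrite enorm_sqr (bigD1 i) //= lerDl sumr_ge0 // => j _; exact: sqr_ge0.
Qed.

(** The inequality [(a - b)^2 <= 2 a^2 + 2 b^2], summed over the coordinates, replaces the triangle
    inequality for [enorm]. *)
Lemma eball_dist_lt c x y (r : R) : eball c r x -> eball c r y ->
  enorm (x - y) < 2 * r.
Proof.
rewrite /eball /= => xr yr.
have r0 : 0 < r by apply: le_lt_trans xr; exact: enorm_ge0.
rewrite -(@ltr_pXn2r _ 2) ?nnegrE ?enorm_ge0 ?mulr_ge0 ?(ltW r0) //.
rewrite -(@ltr_pXn2r _ 2) ?nnegrE ?enorm_ge0 ?(ltW r0) // in xr.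
rewrite -(@ltr_pXn2r _ 2) ?nnegrE ?enorm_ge0 ?(ltW r0) // in yr.
apply: (@le_lt_trans _ _ (2 * enorm (x - c) ^+ 2 + 2 * enorm (y - c) ^+ 2)).
  rewrite !enorm_sqr !mulr_sumr -big_split /=; apply: ler_sum => i _.
  rewrite !mxE; set a := x _ _; set b := y _ _; set e := c _ _.
  by have := sqr_ge0 (a - e + (b - e)); nra.
rewrite exprMn; lra.
Qed.

Lemma measurable_enormB c : measurable_fun setT (fun x => enorm (x - c)).
Proof.
apply: (@measurableT_comp _ _ _ _ _ _ (@Num.sqrt R)).
  by apply: continuous_measurable_fun; exact: sqrt_continuous.
apply: measurable_sum => i.
apply: measurable_funX; under eq_fun do rewrite mxE.
by apply: measurable_funD => //; exact: measurable_coor.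
Qed.

Lemma measurable_eball c (r : R) : measurable (eball c r).
Proof.
have -> : eball c r = (fun x => enorm (x - c)) @^-1` `]-oo, r[.
  by apply/seteqP; split=> x /=; rewrite /eball /= in_itv.
by rewrite -[_ @^-1` _]setTI; apply: measurable_enormB.
Qed.

(** The ball contains the cube of half-side [r / d], because [d (r / d)^2 <= r^2], and lies in that
    of half-side [r], which gives finiteness. A lower bound on the volume is enough, since atoms are
    bounded by nonpositive powers of it. *)
Lemma lebesgue_rV_eball c (r : R) : (0 < d)%N -> 0 < r ->
  exists V : R, [/\ 0 < V, lebesgue_rV R d (eball c r) = V%:E &
    (r / d%:R *+ 2) ^+ d <= V].
Proof.
move=> d0 r0; have dR : 0 < d%:R :> R by rewrite ltr0n.
have rd0 : 0 < r / d%:R by rewrite divr_gt0.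
have sub1 : ball c (r / d%:R) `<=` eball c r.
  move=> x /(rV_ballP _ _ rd0) b; rewrite /eball /=.
  rewrite -(@ltr_pXn2r _ 2) ?nnegrE ?enorm_ge0 ?(ltW r0) // enorm_sqr.
  apply: (@lt_le_trans _ _ (\sum_(i < d) (r / d%:R) ^+ 2)).
    apply: ltr_sum => [|i _]; first by apply/hasP; exists (Ordinal d0); rewrite ?mem_index_enum.
    rewrite !mxE -[ltLHS]real_normK ?num_real // ltr_pXn2r ?nnegrE ?divr_ge0
      ?ler0n ?(ltW r0) //.
    by rewrite distrC; exact: b.
  rewrite sumr_const card_ord -[leLHS]mulr_natr exprMn -mulrA.
  rewrite ler_piMr ?sqr_ge0 // expr2 -mulrA mulVf ?lt0r_neq0 // mulr1.
  by rewrite invf_le1 // ler1n.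
have sub2 : eball c r `<=` ball c r.
  move=> x; rewrite /eball /= => xr; apply/rV_ballP => // i; rewrite /ball /= distrC.
  by apply: le_lt_trans xr; have := coor_le_enorm (x - c) i; rewrite !mxE.
have m1 := measurable_rV_ball c rd0.
have m2 := measurable_rV_ball c r0.
have mE := measurable_eball c r.
have le1 : (lebesgue_rV R d (ball c (r / d%:R)) <= lebesgue_rV R d (eball c r))%E.
  by apply: le_measure sub1; exact: mem_set.
have le2 : (lebesgue_rV R d (eball c r) <= lebesgue_rV R d (ball c r))%E.
  by apply: le_measure sub2; exact: mem_set.
move: le1 le2; rewrite !lebesgue_rV_ball //.
case: (lebesgue_rV R d (eball c r)) => [V| |] //=.
rewrite lee_fin => h _; exists V; split => //.
by apply: lt_le_trans h; rewrite exprn_gt0 // pmulrn_lgt0 // divr_gt0.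
Qed.

End enorm_lemmas.

(** * Complex-valued functions *)

Section normc_lemmas.
Variable R : realType.
Implicit Types z w : R[i].
Local Notation nc := (@Normc.normc R).

Lemma normc_ge0 z : 0 <= nc z.
Proof. by case: z => a b; exact: sqrtr_ge0. Qed.

Lemma normc_sqr z : nc z ^+ 2 = complex.Re z ^+ 2 + complex.Im z ^+ 2.
Proof. by case: z => a b /=; rewrite sqr_sqrtr // addr_ge0 ?sqr_ge0. Qed.

Lemma normcD z w : nc (z + w) <= nc z + nc w.
Proof. by have /andP[_] := ComplexField.lec_normD z w. Qed.

Lemma normc_sum (I : Type) (r : seq I) (F : I -> R[i]) :
  nc (\sum_(i <- r) F i) <= \sum_(i <- r) nc (F i).
Proof.
elim: r => [|i r IH]; first by rewrite !big_nil Normc.normc0.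
by rewrite !big_cons; apply: le_trans (normcD _ _) _; rewrite lerD2l.
Qed.

Lemma normc_conj z : nc (conjc z) = nc z.
Proof. by case: z => a b /=; rewrite sqrrN. Qed.

Lemma normcN z : nc (- z) = nc z.
Proof. by case: z => a b /=; rewrite !sqrrN. Qed.

Lemma normcR (a : R) : nc a%:C%C = `|a|.
Proof. by rewrite /= expr0n /= addr0 sqrtr_sqr. Qed.

Lemma ler_Re_normc z : `|complex.Re z| <= nc z.
Proof.
rewrite -(@ler_pXn2r _ 2) ?nnegrE ?normc_ge0 // normc_sqr real_normK ?num_real //.
by rewrite lerDl sqr_ge0.
Qed.

Lemma ler_Im_normc z : `|complex.Im z| <= nc z.
Proof.
rewrite -(@ler_pXn2r _ 2) ?nnegrE ?normc_ge0 // normc_sqr real_normK ?num_real //.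
by rewrite lerDr sqr_ge0.
Qed.

Lemma normc_sqrD_le z w : nc (z + w) ^+ 2 <= 2 * nc z ^+ 2 + 2 * nc w ^+ 2.
Proof.
apply: (@le_trans _ _ ((nc z + nc w) ^+ 2)).
  by rewrite ler_pXn2r ?nnegrE ?addr_ge0 ?normc_ge0 // normcD.
by have := sqr_ge0 (nc z - nc w); nra.
Qed.

End normc_lemmas.

Section complex_L2.
Variables (R : realType) (d : nat) (X : set 'rV[R]_d).
Hypothesis mX : measurable X.
Local Notation mu := (lebesgue_rV R d).
Local Notation nc := (@Normc.normc R).
Implicit Types f g h : 'rV[R]_d -> R[i].

Lemma cmeasurableD f g : cmeasurable X f -> cmeasurable X g ->
  cmeasurable X (fun x => f x + g x).
Proof.
move=> [f1 f2] [g1 g2]; split.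
  by under eq_fun do rewrite raddfD; exact: measurable_funD.
by under eq_fun do rewrite raddfD; exact: measurable_funD.
Qed.

Lemma cmeasurableN f : cmeasurable X f -> cmeasurable X (fun x => - f x).
Proof.
move=> [f1 f2]; split.
  by under eq_fun do rewrite raddfN; exact: measurable_funN.
by under eq_fun do rewrite raddfN; exact: measurable_funN.
Qed.

Lemma cmeasurableM f g : cmeasurable X f -> cmeasurable X g ->
  cmeasurable X (fun x => f x * g x).
Proof.
move=> [f1 f2] [g1 g2].
have e1 x : complex.Re (f x * g x) = complex.Re (f x) * complex.Re (g x)
    - complex.Im (f x) * complex.Im (g x) by case: (f x) (g x) => ? ? [].
have e2 x : complex.Im (f x * g x) = complex.Re (f x) * complex.Im (g x)
    + complex.Im (f x) * complex.Re (g x) by case: (f x) (g x) => ? ? [].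
split.
  under eq_fun do rewrite e1.
  by apply: measurable_funB; exact: measurable_funM.
under eq_fun do rewrite e2.
by apply: measurable_funD; exact: measurable_funM.
Qed.

Lemma cmeasurable_cst (z : R[i]) : cmeasurable X (fun=> z).
Proof. by split; exact: measurable_cst. Qed.

Lemma cmeasurable_conj f : cmeasurable X f -> cmeasurable X (fun x => conjc (f x)).
Proof.
move=> [f1 f2]; split.
  by rewrite (_ : (fun _ => _) = (fun x => complex.Re (f x))) //;
    apply/funext => x; case: (f x).
rewrite (_ : (fun _ => _) = (fun x => - complex.Im (f x))).
  exact: measurable_funN.
by apply/funext => x; case: (f x).
Qed.

Lemma measurable_normc f : cmeasurable X f -> measurable_fun X (fun x => nc (f x)).
Proof.
move=> [f1 f2].
have -> : (fun x => nc (f x)) =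
   (@Num.sqrt R) \o (fun x => complex.Re (f x) ^+ 2 + complex.Im (f x) ^+ 2).
  by apply/funext => x /=; case: (f x).
apply: measurableT_comp; first by apply: continuous_measurable_fun; exact: sqrt_continuous.
by apply: measurable_funD; exact: measurable_funX.
Qed.

Lemma measurable_normc2 f : cmeasurable X f ->
  measurable_fun X (fun x => (nc (f x) ^+ 2)%:E).
Proof.
by move=> /measurable_normc mf; apply/measurable_EFinP; exact: measurable_funX.
Qed.

Lemma cintegrable_le f (u : 'rV[R]_d -> R) : cmeasurable X f ->
  (forall x, X x -> nc (f x) <= u x) -> mu.-integrable X (EFin \o u) ->
  cintegrable X f.
Proof.
move=> [f1 f2] fu iu; split; apply: le_integrable iu => //.
- exact/measurable_EFinP.
- move=> x Xx; rewrite /= lee_fin.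
  apply: le_trans (ler_Re_normc _) _.
  by apply: le_trans (fu x Xx) (ler_norm _).
- exact/measurable_EFinP.
- move=> x Xx; rewrite /= lee_fin.
  apply: le_trans (ler_Im_normc _) _.
  by apply: le_trans (fu x Xx) (ler_norm _).
Qed.

Lemma cintegrable_normc f : cintegrable X f ->
  mu.-integrable X (fun x => (nc (f x))%:E).
Proof.
move=> [i1 i2].
have m1 := measurable_int _ i1; have m2 := measurable_int _ i2.
have cm : cmeasurable X f by split; exact/measurable_EFinP.
have := integrableD mX (integrable_abse i1) (integrable_abse i2).
apply: le_integrable => //; first by apply/measurable_EFinP; exact: measurable_normc.
move=> x Xx /=; rewrite lee_fin ger0_norm ?normc_ge0 // [leRHS]ger0_norm ?addr_ge0 //.
rewrite {1}[f x]complexE; apply: le_trans (normcD _ _) _.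
rewrite Normc.normcM !normcR (_ : nc 'i%C = 1) ?mul1r //.
by rewrite /= expr0n expr1n /= add0r sqrtr1.
Qed.

Lemma cintegralD f g : cintegrable X f -> cintegrable X g ->
  cintegral X (fun x => f x + g x) = cintegral X f + cintegral X g.
Proof.
move=> [f1 f2] [g1 g2]; rewrite /cintegral.
by rewrite [RHS]/(_ + _) /=; congr Complex; rewrite -RintegralD //;
  apply: eq_Rintegral => x _; rewrite raddfD.
Qed.

Lemma cintegralZ (z : R[i]) f : cintegrable X f ->
  cintegral X (fun x => z * f x) = z * cintegral X f.
Proof.
move=> [f1 f2]; rewrite /cintegral; case: z => a b.
have iZ (c : R) u : mu.-integrable X (fun x => (u x)%:E) ->
    mu.-integrable X (EFin \o (fun x => c * u x)).
  move=> iu; rewrite (_ : _ \o _ = (fun x => c%:E * (u x)%:E)%E) //.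
  exact: integrableZl.
rewrite [RHS]/(_ * _) /=; congr Complex.
  rewrite -[X in _ = X - _]RintegralZl // -[X in _ = _ - X]RintegralZl //.
  rewrite -RintegralB //; [|exact: iZ|exact: iZ].
  by apply: eq_Rintegral => x _; case: (f x).
rewrite -[X in _ = X + _]RintegralZl // -[X in _ = _ + X]RintegralZl //.
rewrite -RintegralD //; [|exact: iZ|exact: iZ].
by apply: eq_Rintegral => x _; case: (f x).
Qed.

Lemma cintegrableD f g : cintegrable X f -> cintegrable X g ->
  cintegrable X (fun x => f x + g x).
Proof.
move=> [f1 f2] [g1 g2]; split.
  under eq_fun do rewrite raddfD EFinD; exact: integrableD.
under eq_fun do rewrite raddfD EFinD; exact: integrableD.
Qed.

Lemma cintegrableZ (z : R[i]) f : cintegrable X f -> cintegrable X (fun x => z * f x).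
Proof.
move=> fi; have := cintegrable_normc fi.
move=> /(integrableZl mX (nc z)) h.
apply: (@cintegrable_le _ (fun x => nc z * nc (f x))) => //.
  apply: cmeasurableM; first exact: cmeasurable_cst.
  by case: fi => i1 i2; split; apply/measurable_EFinP; exact: (measurable_int mu).
by move=> x _; rewrite Normc.normcM.
Qed.

Lemma cintegral0 : cintegral X (fun=> 0 : R[i]) = 0.
Proof. by rewrite /cintegral !Rintegral_cst //= mul0r. Qed.

End complex_L2.

(** * Orthonormal expansions *)

Lemma ereal_cvg0_lt (R : realType) (u : nat -> \bar R) (e : R) :
  u @ \oo --> 0%E -> 0 < e -> exists N0, forall N, (N0 <= N)%N -> (u N < e%:E)%E.
Proof.
move=> u0 e0.
have [N0 _ H] : \forall N \near \oo, (u N < e%:E)%E.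
  have e_nbhs : nbhs (0 : R) (fun r => (r%:E < e%:E)%E).
    apply/nbhs_ballP; exists e => // r.
    by rewrite /ball /= sub0r normrN lte_fin => /(le_lt_trans (ler_norm _)).
  exact: (u0 [set y | (y < e%:E)%E] e_nbhs).
by exists N0 => N /H.
Qed.

Section L2_space.
Variables (R : realType) (d : nat) (X : set 'rV[R]_d).
Hypothesis mX : measurable X.
Local Notation mu := (lebesgue_rV R d).
Local Notation nc := (@Normc.normc R).
Implicit Types f g h : 'rV[R]_d -> R[i].

Lemma cLnorm2_sqr f :
  (cLnorm 2%:E X f `^ 2 = \int[mu]_(x in X) (nc (f x) ^+ 2)%:E)%E.
Proof.
rewrite /cLnorm poweR_Lnorm // [RHS]integral_mkcond.
apply: eq_integral => x _; rewrite /patch; case: ifP => _ /=.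
  by rewrite ger0_norm ?normc_ge0 // powR_mulrn ?normc_ge0.
by rewrite normr0 powR0.
Qed.

Lemma cLnorm2_le f (e : R) : 0 <= e -> (cLnorm 2%:E X f <= e%:E)%E ->
  (\int[mu]_(x in X) (nc (f x) ^+ 2)%:E <= (e ^+ 2)%:E)%E.
Proof.
move=> e0 fe; rewrite -cLnorm2_sqr -powR_mulrn // -poweR_EFin.
by apply: gt0_ler_poweR => //; rewrite in_itv /= ?leey ?andbT ?lee_fin // Lnorm_ge0.
Qed.

Lemma integrable_normc2 f : inL2 X f ->
  mu.-integrable X (fun x => (nc (f x) ^+ 2)%:E).
Proof.
move=> [mf foo]; apply/integrableP; split; first exact: measurable_normc2.
under eq_integral do rewrite /= ger0_norm ?sqr_ge0 //.
by rewrite -cLnorm2_sqr poweR_lty.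
Qed.

Lemma inL2_integrable f : cmeasurable X f ->
  mu.-integrable X (fun x => (nc (f x) ^+ 2)%:E) -> inL2 X f.
Proof.
move=> mf /integrableP[_ foo]; split => //.
apply: (@lty_poweRy _ _ 2) => //; rewrite cLnorm2_sqr.
by apply: le_lt_trans foo; apply: ge0_le_integral => //;
  [move=> x _; rewrite lee_fin sqr_ge0|exact: measurable_normc2|
   apply: measurableT_comp => //; exact: measurable_normc2|
   move=> x _; exact: lee_abs].
Qed.

Lemma inL2D f g : inL2 X f -> inL2 X g -> inL2 X (fun x => f x + g x).
Proof.
move=> fL gL; have mfg := cmeasurableD (proj1 fL) (proj1 gL).
apply: inL2_integrable => //.
have := integrableD mX (integrableZl mX 2 (integrable_normc2 fL))
  (integrableZl mX 2 (integrable_normc2 gL)).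
apply: le_integrable => //; first exact: measurable_normc2.
move=> x _ /=; rewrite lee_fin ger0_norm ?sqr_ge0 //.
by apply: le_trans (normc_sqrD_le _ _) (ler_norm _).
Qed.

Lemma inL2Z (z : R[i]) f : inL2 X f -> inL2 X (fun x => z * f x).
Proof.
move=> fL; apply: inL2_integrable.
  by apply: cmeasurableM; [exact: cmeasurable_cst|exact: (proj1 fL)].
rewrite (_ : (fun _ => _) = (fun x => (nc z ^+ 2)%:E * (nc (f x) ^+ 2)%:E)%E).
  by apply: integrableZl => //; exact: integrable_normc2.
by apply/funext => x; rewrite Normc.normcM exprMn EFinM.
Qed.

Lemma inL2_0 : inL2 X (fun=> 0).
Proof.
apply: inL2_integrable; first exact: cmeasurable_cst.
by under eq_fun do rewrite Normc.normc0 expr0n /=; exact: integrable0.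
Qed.

Lemma inL2_sum (I : Type) (r : seq I) (F : I -> 'rV[R]_d -> R[i]) :
  (forall i, inL2 X (F i)) -> inL2 X (fun x => \sum_(i <- r) F i x).
Proof.
move=> LF; elim: r => [|i r IH].
  by under eq_fun do rewrite big_nil; exact: inL2_0.
by under eq_fun do rewrite big_cons; exact: inL2D.
Qed.

Lemma cintegrable_L2dot f g : inL2 X f -> inL2 X g ->
  cintegrable X (fun x => f x * conjc (g x)).
Proof.
move=> fL gL.
apply: (@cintegrable_le _ _ _ mX _ (fun x => nc (f x) ^+ 2 + nc (g x) ^+ 2)).
- by apply: cmeasurableM; [exact: (proj1 fL)|apply: cmeasurable_conj; exact: (proj1 gL)].
- move=> x _; rewrite Normc.normcM normc_conj.
  by have := sqr_ge0 (nc (f x) - nc (g x)); have := normc_ge0 (f x);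
    have := normc_ge0 (g x); nra.
- by rewrite (_ : _ \o _ = (fun x => (nc (f x) ^+ 2)%:E) \+ (fun x => (nc (g x) ^+ 2)%:E))%E //;
    apply: integrableD => //; exact: integrable_normc2.
Qed.

Lemma L2dotDl f g h : inL2 X f -> inL2 X g -> inL2 X h ->
  L2dot X (fun x => f x + g x) h = L2dot X f h + L2dot X g h.
Proof.
move=> fL gL hL; rewrite /L2dot -cintegralD //; try exact: cintegrable_L2dot.
by congr cintegral; apply/funext => x; rewrite mulrDl.
Qed.

Lemma L2dotZl (z : R[i]) f h : inL2 X f -> inL2 X h ->
  L2dot X (fun x => z * f x) h = z * L2dot X f h.
Proof.
move=> fL hL; rewrite /L2dot -cintegralZ //; last exact: cintegrable_L2dot.
by congr cintegral; apply/funext => x; rewrite mulrA.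
Qed.

Lemma L2dot0l f : L2dot X (fun=> 0) f = 0.
Proof. by rewrite /L2dot; under eq_fun do rewrite mul0r; exact: cintegral0. Qed.

Lemma L2dot_self f : inL2 X f ->
  L2dot X f f = (\int[mu]_(x in X) (nc (f x) ^+ 2))%:C%C.
Proof.
move=> fL; rewrite /L2dot /cintegral /=; congr Complex.
  by apply: eq_Rintegral => x _; rewrite normc_sqr; case: (f x) => a b /=; ring.
transitivity (\int[mu]_(x in X) (0 : R)).
  by apply: eq_Rintegral => x _; case: (f x) => a b /=; ring.
by rewrite Rintegral_cst // mul0r.
Qed.

Lemma L2_pythagoras (z : R[i]) f g : inL2 X f -> inL2 X g -> L2dot X g f = 0 ->
  \int[mu]_(x in X) (nc (z * f x + g x) ^+ 2) =
  nc z ^+ 2 * \int[mu]_(x in X) (nc (f x) ^+ 2) + \int[mu]_(x in X) (nc (g x) ^+ 2).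
Proof.
move=> fL gL fg0.
have if2 := integrable_normc2 fL; have ig2 := integrable_normc2 gL.
have igf := cintegrableZ mX (conjc z) (cintegrable_L2dot gL fL).
(* The cross term is written so that its integral is the real part of a multiple of [L2dot X g f],
   which vanishes. *)
have -> : \int[mu]_(x in X) (nc (z * f x + g x) ^+ 2) =
   \int[mu]_(x in X) ((nc z ^+ 2 * nc (f x) ^+ 2 + nc (g x) ^+ 2) +
      2 * complex.Re (conjc z * (g x * conjc (f x)))).
  apply: eq_Rintegral => x _; rewrite !normc_sqr.
  by case: z {igf} (f x) (g x) => a b [e1 e2] [h1 h2] /=; ring.
have iz2 : mu.-integrable X (EFin \o (fun x => nc z ^+ 2 * nc (f x) ^+ 2)).
  exact: (integrableZl mX _ if2).
rewrite RintegralD //; last 2 first.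
- exact: (integrableD mX iz2 ig2).
- exact: (integrableZl mX 2 (proj1 igf)).
rewrite RintegralD // RintegralZl // RintegralZl //; last exact: (proj1 igf).
have := cintegralZ mX (conjc z) (cintegrable_L2dot gL fL).
rewrite -/(L2dot X g f) fg0 mulr0 => /(congr1 (@complex.Re R)) /= ->.
by rewrite mulr0 addr0.
Qed.

Section basis.
Variable phi : {ffun 'I_d -> nat} -> 'rV[R]_d -> R[i].
Hypothesis onb : orthonormal_basis X phi.
(** Arbitrary coefficients, because both [<a, phi_n>] and [r^|n| <a, phi_n>] will occur. *)
Variable b : {ffun 'I_d -> nat} -> R[i].
Local Notation S r := (fun x => \sum_(n <- r) b n * phi n x).

Lemma inL2_onb_sum (r : seq {ffun 'I_d -> nat}) : inL2 X (S r).
Proof. by apply: inL2_sum => n; apply: inL2Z; exact: onb_L2. Qed.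

Lemma L2dot_onb_sum (r : seq {ffun 'I_d -> nat}) m :
  L2dot X (S r) (phi m) = \sum_(n <- r) b n * (n == m)%:R.
Proof.
elim: r => [|n r IH]; first by rewrite big_nil -[RHS](L2dot0l (phi m));
  congr L2dot; apply/funext => x; rewrite big_nil.
rewrite big_cons -IH -(onb_orthonormal onb) -L2dotZl; [|exact: onb_L2..].
rewrite -L2dotDl; [|by apply: inL2Z; exact: onb_L2|exact: inL2_onb_sum|exact: onb_L2].
by congr L2dot; apply/funext => x; rewrite big_cons.
Qed.

Lemma onb_sum_norm (r : seq {ffun 'I_d -> nat}) : uniq r ->
  \int[mu]_(x in X) (nc (\sum_(n <- r) b n * phi n x) ^+ 2) =
  \sum_(n <- r) nc (b n) ^+ 2.
Proof.
elim: r => [|n r IH] /=.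
  move=> _; under eq_Rintegral do rewrite big_nil Normc.normc0 expr0n /=.
  by rewrite big_nil Rintegral_cst // mul0r.
move=> /andP[nr ur]; rewrite big_cons -IH //.
transitivity (\int[mu]_(x in X) nc (b n * phi n x + \sum_(m <- r) b m * phi m x) ^+ 2).
  by apply: eq_Rintegral => x _; rewrite big_cons.
rewrite L2_pythagoras //; last 3 first.
- exact: onb_L2.
- exact: inL2_onb_sum.
- rewrite L2dot_onb_sum big_seq big1 // => m mr.
  by case: eqP => [mn|_]; rewrite ?mulr0 //; rewrite -mn mr in nr.
have := onb_orthonormal onb n n.
rewrite L2dot_self; last exact: onb_L2.
by rewrite eqxx => /(congr1 (@complex.Re R)) /= ->; rewrite mulr1.
Qed.

(** For a partial sum [S = T - (T - S)] one has [|S|^2 <= 2 |T|^2 + 2 |T - S|^2], and the integral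
    of the last term tends to 0. The integral of [|T|^2] may be infinite. *)
Lemma onb_coef_le (T : 'rV[R]_d -> R[i]) (N : nat) : cmeasurable X T ->
  L2cvg X (fun M x => midx_sum M (fun n => b n * phi n x)) T ->
  ((\sum_(n <- box d N) nc (b n) ^+ 2)%:E <=
   2%:E * \int[mu]_(x in X) (nc (T x) ^+ 2)%:E)%E.
Proof.
move=> mT cvT; apply/lee_addgt0Pr => e e0.
(* With [T - S] below [sqrt (e / 2)] in [L^2], twice its square integral is at most [e]. *)
have e2 : 0 < Num.sqrt (e / 2) by rewrite sqrtr_gt0 divr_gt0.
have [N0 HN0] := ereal_cvg0_lt cvT e2.
(* Enlarging the box only increases the sum of squares, so the error may be made small after [N] is
   fixed. *)
pose M := maxn N N0; have := HN0 M (leq_maxr _ _).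
move=> /ltW /(cLnorm2_le (ltW e2)); rewrite sqr_sqrtr ?divr_ge0 ?(ltW e0) // => h.
have mS : cmeasurable X (S (box d M)) by exact: (proj1 (inL2_onb_sum _)).
have mD : cmeasurable X (fun x => T x - \sum_(n <- box d M) b n * phi n x).
  by apply: cmeasurableD => //; exact: cmeasurableN.
apply: (@le_trans _ _ (\sum_(n <- box d M) nc (b n) ^+ 2)%:E).
  rewrite lee_fin; apply: ler_sum_uniq; rewrite ?box_uniq // => [n].
    by rewrite !mem_box => /leq_trans; apply; exact: leq_maxl.
  by rewrite sqr_ge0.
rewrite -onb_sum_norm ?box_uniq // /Rintegral fineK; last first.
  by apply: integrable_fin_num => //; apply: integrable_normc2; exact: inL2_onb_sum.
apply: (@le_trans _ _ (\int[mu]_(x in X) (2%:E * (nc (T x) ^+ 2)%:E +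
   2%:E * (nc (T x - \sum_(n <- box d M) b n * phi n x) ^+ 2)%:E))%E).
  apply: ge0_le_integral => //.
  - by move=> x _; rewrite lee_fin sqr_ge0.
  - exact: measurable_normc2.
  - apply: emeasurable_funD; apply: emeasurable_funM => //; exact: measurable_normc2.
  - move=> x _; rewrite -!EFinM -EFinD lee_fin.
    rewrite -[X in nc X](_ : T x - (T x - \sum_(n <- box d M) b n * phi n x) = _); last first.
      by rewrite opprB addrC subrK.
    apply: le_trans (normc_sqrD_le _ _) _.
    by rewrite (normcN (T x - _)).
rewrite ge0_integralD //; last 4 first.
- by move=> x _; rewrite -EFinM lee_fin mulr_ge0 ?sqr_ge0.
- by apply: emeasurable_funM => //; exact: measurable_normc2.
- by move=> x _; rewrite -EFinM lee_fin mulr_ge0 ?sqr_ge0.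
- by apply: emeasurable_funM => //; exact: measurable_normc2.
rewrite !ge0_integralZl //; try by [move=> x _; rewrite lee_fin sqr_ge0
  |exact: measurable_normc2].
rewrite leeD2l //; apply: (@le_trans _ _ (2%:E * (e / 2)%:E)%E).
  rewrite lee_pmul2l //; apply: le_trans h.
  by apply: ge0_le_integral => //; [move=> x _; rewrite lee_fin sqr_ge0
   |exact: measurable_normc2
   |rewrite /=; under eq_fun do rewrite midx_sum_box; exact: measurable_normc2
   |move=> x _; rewrite midx_sum_box].
by rewrite -EFinM lee_fin mulrC divfK.
Qed.

End basis.
End L2_space.

(** * Kernels on product domains *)

Section product_domain.
Variables (R : realType) (d : nat) (X : set 'rV[R]_d).
Hypothesis mX : measurable X.
Local Notation E := 'rV[R]_d.
Local Notation mu := (lebesgue_rV R d).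

Lemma measurable_restrict_prod (H : E * E -> \bar R) :
  measurable_fun (X `*` X) H -> measurable_fun setT (H \_ (X `*` X)).
Proof. by move=> mH; apply/(measurable_restrictT _ _).1 => //; exact: measurableX. Qed.

Lemma restrict_prodE (H : E * E -> \bar R) x y : X x -> X y ->
  (H \_ (X `*` X)) (x, y) = H (x, y).
Proof. by move=> Xx Xy; rewrite /patch mem_set. Qed.

Lemma integral_restrict_prod1 (H : E * E -> \bar R) y : X y ->
  (\int[mu]_(x in X) H (x, y) = \int[mu]_x (H \_ (X `*` X)) (x, y))%E.
Proof.
move=> Xy; rewrite integral_mkcond; apply: eq_integral => x _.
by rewrite /patch in_setX /= (mem_set Xy) andbT.
Qed.

Lemma measurable_section (H : E * E -> R) x : X x ->
  measurable_fun (X `*` X) H -> measurable_fun X (fun y => H (x, y)).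
Proof.
move=> Xx mH; apply/measurable_EFinP.
have mEH : measurable_fun (X `*` X) (EFin \o H) by exact/measurable_EFinP.
have := measurableT_comp (measurable_restrict_prod mEH) (pair1_measurable x).
move/(@measurable_funTS _ _ _ _ X); apply: eq_measurable_fun => y /set_mem Xy.
by rewrite /= restrict_prodE.
Qed.

(** Tonelli's theorem gives this for nonnegative functions on the whole space: extend [H] by 0 and
    treat its positive and negative parts separately. The integrals in [x] need not converge. *)
Lemma measurable_integral_prod1 (H : E * E -> \bar R) :
  measurable_fun (X `*` X) H ->
  measurable_fun X (fun y => \int[mu]_(x in X) H (x, y))%E.
Proof.
move=> /measurable_restrict_prod; set H' := H \_ _ => mH'.
have mG : measurable_fun setT (fun y => \int[mu]_x H' (x, y))%E.
  under eq_fun do rewrite integralE.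
  apply: emeasurable_funB.
    have mp := measurable_funepos mH'.
    have := measurable_fun_fubini_tonelli_G (m1 := mu) _ mp (funepos_ge0 H').
    apply: eq_measurable_fun => y _; rewrite /fubini_G; apply: eq_integral => x _.
    by rewrite !unlock.
  have mn := measurable_funeneg mH'.
  have := measurable_fun_fubini_tonelli_G (m1 := mu) _ mn (funeneg_ge0 H').
  apply: eq_measurable_fun => y _; rewrite /fubini_G; apply: eq_integral => x _.
  by rewrite !unlock.
apply: eq_measurable_fun (measurable_funTS mG) => y /set_mem Xy.
by rewrite integral_restrict_prod1.
Qed.

Lemma measurable_swap_prod d' (T : measurableType d') (H : E * E -> T) :
  measurable_fun (X `*` X) H ->
  measurable_fun (X `*` X) (fun z => H (z.2, z.1)).
Proof.
move=> mH; apply: (measurable_comp (F := X `*` X)) => //.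
- exact: measurableX.
- by move=> _ [z [Xz1 Xz2] <-].
- by apply: measurable_funTS; apply: measurable_fun_pair.
Qed.

Lemma measurable_section2 (H : E * E -> R) y : X y ->
  measurable_fun (X `*` X) H -> measurable_fun X (fun x => H (x, y)).
Proof.
move=> Xy mH; exact: (@measurable_section (fun z => H (z.2, z.1)) y Xy
  (measurable_swap_prod mH)).
Qed.

Lemma measurable_cintegral_kernel (H : E -> E -> R[i]) (a : E -> R[i]) :
  measurable_fun (X `*` X) (fun z => complex.Re (H z.1 z.2)) ->
  measurable_fun (X `*` X) (fun z => complex.Im (H z.1 z.2)) ->
  cmeasurable X a ->
  cmeasurable X (fun y => cintegral X (fun x => H x y * a x)).
Proof.
move=> m1 m2 [a1 a2].
have lift (u : E -> R) : measurable_fun X u ->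
    measurable_fun (X `*` X) (fun z : E * E => u z.1).
  move=> mu'; apply: (measurable_comp (F := X)) => //.
    by move=> _ [z [Xz _] <-].
  exact: measurable_funTS.
have l1 := lift _ a1; have l2 := lift _ a2.
split; rewrite /cintegral /= /Rintegral.
  apply: (measurableT_comp (fine_measurable measurableT)) => //.
  apply: (@measurable_integral_prod1 (fun z => (complex.Re (H z.1 z.2 * a z.1))%:E)).
  apply/measurable_EFinP.
  rewrite (_ : (fun _ => _) = (fun z => complex.Re (H z.1 z.2) * complex.Re (a z.1)
     - complex.Im (H z.1 z.2) * complex.Im (a z.1))).
    by apply: measurable_funB; exact: measurable_funM.
  by apply/funext => z; case: (H _ _) (a _) => ? ? [].
apply: (measurableT_comp (fine_measurable measurableT)) => //.
apply: (@measurable_integral_prod1 (fun z => (complex.Im (H z.1 z.2 * a z.1))%:E)).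
apply/measurable_EFinP.
rewrite (_ : (fun _ => _) = (fun z => complex.Re (H z.1 z.2) * complex.Im (a z.1)
   + complex.Im (H z.1 z.2) * complex.Re (a z.1))).
  by apply: measurable_funD; exact: measurable_funM.
by apply/funext => z; case: (H _ _) (a _) => ? ? [].
Qed.

Lemma tonelli_prod (H : E * E -> \bar R) :
  measurable_fun (X `*` X) H -> (forall z, 0 <= H z)%E ->
  (\int[mu]_(y in X) \int[mu]_(x in X) H (x, y) =
   \int[mu]_(x in X) \int[mu]_(y in X) H (x, y))%E.
Proof.
move=> /measurable_restrict_prod mH' H0.
transitivity (\int[mu]_y \int[mu]_x (H \_ (X `*` X)) (x, y))%E.
  rewrite integral_mkcond; apply: eq_integral => y _; rewrite [in LHS]/patch.
  case: ifPn => Xy; first by rewrite integral_restrict_prod1 //; exact: set_mem.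
  rewrite (eq_integral (cst 0%E)) ?integral0 // => x _.
  by rewrite /patch in_setX /= (negbTE Xy) andbF.
rewrite -fubini_tonelli //; last first.
  by move=> z; rewrite /patch; case: ifP.
rewrite [RHS]integral_mkcond; apply: eq_integral => x _; rewrite [in RHS]/patch.
case: ifPn => Xx.
  rewrite [RHS]integral_mkcond; apply: eq_integral => y _.
  by rewrite /patch in_setX /= Xx.
rewrite (eq_integral (cst 0%E)) ?integral0 // => y _.
by rewrite /patch in_setX /= (negbTE Xx).
Qed.

End product_domain.

(** Hoelder's inequality with exponents 2 and 2 for [f * sqrt w] and [sqrt w]. The weight will be
    [w = |a|], so that the [L^1] norm of the atom enters. *)
Lemma integral_cauchy_schwarz (R : realType) (d : nat) (X : set 'rV[R]_d)
    (f w : 'rV[R]_d -> R) :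
  measurable X -> measurable_fun X f -> measurable_fun X w ->
  (forall x, 0 <= f x) -> (forall x, 0 <= w x) ->
  ((\int[lebesgue_rV R d]_(x in X) (f x * w x)%:E) `^ 2 <=
   (\int[lebesgue_rV R d]_(x in X) (f x ^+ 2 * w x)%:E) *
   (\int[lebesgue_rV R d]_(x in X) (w x)%:E))%E.
Proof.
move=> mX mf mw f0 w0; set mu := lebesgue_rV R d.
pose v x := Num.sqrt (w x).
have mv : measurable_fun X v.
  by apply: measurableT_comp mw; apply: continuous_measurable_fun; exact: sqrt_continuous.
pose F := (fun x => f x * v x) \_ X; pose G := v \_ X.
have mF : measurable_fun setT F.
  by apply/(measurable_restrictT _ _).1 => //; exact: measurable_funM.
have mG : measurable_fun setT G by apply/(measurable_restrictT _ _).1.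
have vv x : v x * v x = w x by rewrite -expr2 sqr_sqrtr.
have v0 x : 0 <= v x by exact: sqrtr_ge0.
have half : 2^-1 + 2^-1 = 1 :> R by rewrite -div1r -splitr.
have := hoelder mu mF mG (ltr0Sn R 1) (ltr0Sn R 1) half.
move=> /(@gt0_ler_poweR R 2 (ler0n _ _)).
rewrite !in_itv /= !leey !andbT Lnorm_ge0 mule_ge0 ?Lnorm_ge0 // => /(_ isT isT).
rewrite poweRM ?Lnorm_ge0 // !poweR_Lnorm // Lnorm1.
congr (_ `^ _ <= _ * _)%E.
- rewrite [RHS]integral_mkcond; apply: eq_integral => x _; rewrite /F /G /patch /=.
  by case: ifP => _; rewrite ?mul0r ?normr0 // -mulrA vv ger0_norm ?mulr_ge0.
- rewrite [RHS]integral_mkcond; apply: eq_integral => x _; rewrite /F /patch /=.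
  case: ifP => _; rewrite ?normr0 ?powR0 //.
  by rewrite ger0_norm ?mulr_ge0 // powR_mulrn ?mulr_ge0 // exprMn [v x ^+ 2]expr2 vv.
- rewrite [RHS]integral_mkcond; apply: eq_integral => x _; rewrite /G /patch /=.
  case: ifP => _; rewrite ?normr0 ?powR0 //.
  by rewrite ger0_norm // powR_mulrn // expr2 vv.
Qed.

(** * Measurability of derivatives in a parameter *)

Section measurable_derivative.
Variables (R : realType) (d : nat) (X : set 'rV[R]_d).
Hypothesis oX : open X.
Local Notation E := 'rV[R]_d.
Implicit Types H : E -> E -> R.

(** Difference quotients have to be formed at points of [X], where the sections of the kernel are
    known to be measurable; the steps [e / (2 (n + 1))] stay in the open set. *)
Lemma open_segment_seq (x : E) (i : 'I_d) : X x -> exists u : R ^nat,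
  [/\ forall n, u n != 0, u n @[n --> \oo] --> 0 &
      forall n, X (u n *: unit_vec i + x)].
Proof.
move=> Xx.
have [e /= e0 eX] : nbhs_ball x X by apply/nbhs_ballP; exact: open_nbhs_nbhs.
have e2 : 0 < e / 2 by rewrite divr_gt0.
have h0 n : 0 < (e / 2) * harmonic n :> R by rewrite mulr_gt0 // invr_gt0.
exists (fun n => (e / 2) * harmonic n); split.
- by move=> n; rewrite lt0r_neq0.
- by rewrite -[X in _ --> X](mulr0 (e / 2)); apply: cvgMr; exact: cvg_harmonic.
- move=> n; apply: eX; apply/rV_ballP => // j.
  rewrite /ball /= !mxE distrC addrK.
  apply: (@le_lt_trans _ _ (e / 2)); last lra.
  rewrite normrM ger0_norm ?(ltW (h0 n)) // normr_nat -mulrA ler_piMr ?(ltW e2) //.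
  have hn : harmonic n <= 1 :> R by rewrite /harmonic /= invf_le1 // ler1n.
  by rewrite mulr_ile1 // ?invr_ge0 // lern1; case: (_ && _).
Qed.

(** The invariant for repeated differentiation: a derivative in [x] keeps measurability in [y] and
    lowers [k] by one. *)
Definition measurable_smooth (k : nat) H :=
  (forall x, X x -> measurable_fun X (H x)) /\
  (forall y, X y -> Cn k X (fun x => H x y)).

(** The derivative is a pointwise limit of measurable difference quotients along a sequence of
    steps. *)
Lemma measurable_smooth_derive k H (i : 'I_d) :
  measurable_smooth k.+1 H ->
  measurable_smooth k (fun x y => 'D_(unit_vec i) (fun z => H z y) x).
Proof.
move=> [mH cH]; split; last by move=> y /cH [_ /(_ i)[]].
move=> x Xx; have [u [u0 cu Xu]] := open_segment_seq i Xx.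
apply: (@measurable_fun_cvg _ _ _ _
  (fun n y => (u n)^-1 * (H (u n *: unit_vec i + x) y - H x y))).
  by move=> n; apply: measurable_funM => //; apply: measurable_funB; exact: mH.
move=> y Xy; have [_ /(_ i)[/(_ x Xx) dH _]] := cH y Xy.
exact: ((cvgr_dnbhsP _ _ _).1 dH u (conj u0 cu)).
Qed.

Lemma measurable_smooth_iter k m H (i : 'I_d) : measurable_smooth (m + k) H ->
  measurable_smooth k
    (fun x y => iter m (fun h z => 'D_(unit_vec i) h z) (fun z => H z y) x).
Proof.
elim: m k => [|m IH] k //= H1.
apply: measurable_smooth_derive; apply: IH; by rewrite addnS.
Qed.

Lemma measurable_mderive (k : nat) H (n : {ffun 'I_d -> nat}) (x : E) :
  measurable_smooth k H -> (mdeg n <= k)%N -> X x ->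
  measurable_fun X (fun y => mderive n (fun z => H z y) x).
Proof.
move=> sH nk Xx.
(* The enumeration is generalised to any list of coordinates; [k] minus the number of derivatives
   taken is the smoothness left. *)
suff /(_ (enum 'I_d)) main (l : seq 'I_d) : (\sum_(i <- l) n i <= k)%N ->
    measurable_smooth (k - \sum_(i <- l) n i) (fun x y =>
      foldr (fun i g => iter (n i) (fun h z => 'D_(unit_vec i) h z) g)
        (fun z => H z y) l x).
  by have [|mf _] := main; [rewrite big_enum|exact: mf].
elim: l => [|i l IH]; first by rewrite big_nil subn0.
rewrite big_cons => lk; have lk' := leq_trans (leq_addl _ _) lk.
apply: (@measurable_smooth_iter _ (n i) (fun x y =>
      foldr (fun i g => iter (n i) (fun h z => 'D_(unit_vec i) h z) g)
        (fun z => H z y) l x)).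
have -> : (n i + (k - (n i + \sum_(j <- l) n j)) = k - \sum_(j <- l) n j)%N.
  by rewrite (addnC (n i) (\sum_(j <- l) n j)) subnDA subnKC // leq_subRL // addnC.
exact: IH.
Qed.

End measurable_derivative.

(** The functions [c] and [m] separate the variables of the polynomial, so that for fixed [y] the
    vanishing moments apply termwise. One factor [A] comes from Cauchy-Schwarz with weight [|a|],
    the other from integrating [g^2 |a|] after Tonelli; the factor 2 arises because real and
    imaginary parts are bounded separately. The bound on the remainder is asked only where [a] is
    nonzero, that is, inside the ball of the atom. *)
Lemma integral_kernel_moment_le (R : realType) (d : nat) (X : set 'rV[R]_d)
    (I : Type) (J : seq I) (K : 'rV[R]_d -> 'rV[R]_d -> R[i])
    (c : I -> 'rV[R]_d -> R[i]) (m : I -> 'rV[R]_d -> R)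
    (a : 'rV[R]_d -> R[i]) (A g : R) :
  let mu := lebesgue_rV R d in
  measurable X ->
  measurable_fun (X `*` X) (fun z => complex.Re (K z.1 z.2)) ->
  measurable_fun (X `*` X) (fun z => complex.Im (K z.1 z.2)) ->
  (forall i, cmeasurable X (c i)) -> (forall i, measurable_fun X (m i)) ->
  cmeasurable X a ->
  (forall i, cintegrable X (fun x => a x * (m i x)%:C%C)) ->
  (forall i, cintegral X (fun x => a x * (m i x)%:C%C) = 0) ->
  {ae mu, forall y, X y -> cintegrable X (fun x => K x y * a x)} ->
  (\int[mu]_(x in X) (Normc.normc (a x))%:E <= A%:E)%E ->
  0 <= A -> 0 <= g ->
  (forall x, X x -> a x != 0 ->
    (\int[mu]_(y in X) (Normc.normc (K x y - \sum_(i <- J) c i y * (m i x)%:C%C)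
       ^+ 2)%:E <= (g ^+ 2)%:E)%E) ->
  (\int[mu]_(y in X) (Normc.normc (cintegral X (fun x => K x y * a x)) ^+ 2)%:E
    <= (2 * (A ^+ 2 * g ^+ 2))%:E)%E.
Proof.
move=> mu mX mK1 mK2 mc mm ma im im0 iK aA A0 g0 bound.
pose G x y := K x y - \sum_(i <- J) c i y * (m i x)%:C%C.
pose nc := @Normc.normc R.
have mt1 (u : 'rV[R]_d -> R) : measurable_fun X u ->
    measurable_fun (X `*` X) (fun z : 'rV[R]_d * 'rV[R]_d => u z.1).
  move=> mu'; apply: (measurable_comp (F := X)) => //.
    by move=> _ [z [Xz _] <-].
  exact: measurable_funTS.
have mt2 (u : 'rV[R]_d -> R) : measurable_fun X u ->
    measurable_fun (X `*` X) (fun z : 'rV[R]_d * 'rV[R]_d => u z.2).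
  move=> mu'; apply: (measurable_comp (F := X)) => //.
    by move=> _ [z [_ Xz] <-].
  exact: measurable_funTS.
have ReG x y : complex.Re (G x y) =
    complex.Re (K x y) - \sum_(i <- J) complex.Re (c i y) * m i x.
  rewrite /G raddfB raddf_sum; congr (_ - _); apply: eq_bigr => i _.
  by case: (c i y) => u v /=; rewrite mulr0 subr0.
have ImG x y : complex.Im (G x y) =
    complex.Im (K x y) - \sum_(i <- J) complex.Im (c i y) * m i x.
  rewrite /G raddfB raddf_sum; congr (_ - _); apply: eq_bigr => i _.
  by case: (c i y) => u v /=; rewrite mulr0 add0r.
have mG2 : measurable_fun (X `*` X) (fun z => nc (G z.1 z.2) ^+ 2).
  under eq_fun do rewrite /nc normc_sqr ReG ImG.
  have mcm (u : 'rV[R]_d -> R) i : measurable_fun X u ->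
      measurable_fun (X `*` X) (fun z : 'rV[R]_d * 'rV[R]_d => u z.2 * m i z.1).
    by move=> mu'; apply: measurable_funM; [exact: mt2|exact: (mt1 (m i))].
  apply: measurable_funD; apply: measurable_funX; apply: measurable_funB => //;
    apply: measurable_sum => i.
    exact: (mcm (fun y => complex.Re (c i y)) i (mc i).1).
  exact: (mcm (fun y => complex.Im (c i y)) i (mc i).2).
have mna : measurable_fun X (fun x => nc (a x)) by exact: measurable_normc.
have mJ : measurable_fun (X `*` X) (fun z => (nc (G z.1 z.2) ^+ 2 * nc (a z.1))%:E).
  by apply/measurable_EFinP; apply: measurable_funM => //; exact: (mt1 (fun x => nc (a x))).
have J0 (z : 'rV[R]_d * 'rV[R]_d) : (0 <= (nc (G z.1 z.2) ^+ 2 * nc (a z.1))%:E)%E.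
  by rewrite lee_fin mulr_ge0 ?sqr_ge0 ?normc_ge0.
have mT := measurable_cintegral_kernel mX mK1 mK2 ma.
(* Where the integral defining the operator exists, the polynomial part in [x]
   integrates to 0 against [a], so [K] may be replaced with [G]. *)
have key y : X y -> cintegrable X (fun x => K x y * a x) ->
    ((nc (cintegral X (fun x => K x y * a x)) ^+ 2)%:E <=
     (2 * A)%:E * \int[mu]_(x in X) (nc (G x y) ^+ 2 * nc (a x))%:E)%E.
  move=> Xy iKy.
  have isum (r : seq I) : cintegrable X (fun x => \sum_(i <- r) c i y * (a x * (m i x)%:C%C)) /\
      cintegral X (fun x => \sum_(i <- r) c i y * (a x * (m i x)%:C%C)) = 0.
    elim: r => [|i r [IH1 IH2]].
      rewrite (_ : (fun _ => _) = (fun=> 0)); last by apply/funext => x; rewrite big_nil.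
      split; last exact: cintegral0.
      by split; exact: integrable0.
    rewrite (_ : (fun _ => _) = (fun x => c i y * (a x * (m i x)%:C%C) +
      \sum_(j <- r) c j y * (a x * (m j x)%:C%C))); last by apply/funext => x; rewrite big_cons.
    have iz := cintegrableZ mX (c i y) (im i).
    split; first exact: cintegrableD.
    by rewrite cintegralD // cintegralZ // im0 IH2 mulr0 addr0.
  have [is1 is0] := isum J.
  have eG : (fun x => G x y * a x) = (fun x => K x y * a x +
      (-1) * \sum_(i <- J) c i y * (a x * (m i x)%:C%C)).
    apply/funext => x; rewrite /G mulrBl mulN1r mulr_suml; congr (_ - _).
    by apply: eq_bigr => i _; rewrite -mulrA (mulrC (a x)).
  have iGa : cintegrable X (fun x => G x y * a x).
    by rewrite eG; apply: cintegrableD => //; exact: cintegrableZ.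
  have -> : cintegral X (fun x => K x y * a x) = cintegral X (fun x => G x y * a x).
    by rewrite eG cintegralD // ?cintegralZ // ?is0 ?mulr0 ?addr0 //; exact: cintegrableZ.
  have inGa := cintegrable_normc mX iGa.
  set W := \int[mu]_(x in X) nc (G x y * a x).
  have WE : (W%:E = \int[mu]_(x in X) (nc (G x y) * nc (a x))%:E)%E.
    rewrite /W /Rintegral fineK; last exact: integrable_fin_num.
    by apply: eq_integral => x _; rewrite /nc Normc.normcM.
  have W0 : 0 <= W by apply: Rintegral_ge0 => x _; exact: normc_ge0.
  have TW : nc (cintegral X (fun x => G x y * a x)) ^+ 2 <= 2 * W ^+ 2.
    have sq (u : R) : `|u| <= W -> u ^+ 2 <= W ^+ 2.
      by move=> uW; rewrite -(real_normK (num_real u)) ler_pXn2r ?nnegrE.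
    have part (u : 'rV[R]_d -> R) : mu.-integrable X (EFin \o u) ->
        (forall x, `|u x| <= nc (G x y * a x)) -> `|\int[mu]_(x in X) u x| <= W.
      move=> iu ub; apply: le_trans (le_normr_Rintegral mX iu) _.
      apply: le_Rintegral => //; exact: (integrable_abse iu).
    rewrite normc_sqr /= mulr2n mulrDl mul1r.
    apply: lerD; apply: sq; apply: part.
    - exact: iGa.1.
    - by move=> x; exact: ler_Re_normc.
    - exact: iGa.2.
    - by move=> x; exact: ler_Im_normc.
  have mGy : measurable_fun X (fun x => nc (G x y)).
    apply: measurable_normc; split.
      under eq_fun do rewrite ReG; apply: measurable_funB.
        exact: (measurable_section2 mX (H := fun z => complex.Re (K z.1 z.2)) Xy mK1).
      apply: measurable_sum => i; apply: measurable_funM => //.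
    under eq_fun do rewrite ImG; apply: measurable_funB.
      exact: (measurable_section2 mX (H := fun z => complex.Im (K z.1 z.2)) Xy mK2).
    apply: measurable_sum => i; apply: measurable_funM => //.
  have := integral_cauchy_schwarz mX mGy mna (fun x => normc_ge0 _) (fun x => normc_ge0 _).
  rewrite -WE poweR_EFin powR_mulrn // => CS.
  apply: (@le_trans _ _ (2%:E * (W ^+ 2)%:E)%E); first by rewrite -EFinM lee_fin.
  rewrite (EFinM 2 A) -muleA lee_pmul2l //; apply: le_trans CS _.
  rewrite muleC; apply: lee_wpmul2r => //.
  by apply: integral_ge0 => x _; exact: (J0 (x, y)).
have mI : measurable_fun X (fun y => \int[mu]_(x in X) (nc (G x y) ^+ 2 * nc (a x))%:E)%E.
  exact: (measurable_integral_prod1 mX mJ).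
have I0 y : (0 <= \int[mu]_(x in X) (nc (G x y) ^+ 2 * nc (a x))%:E)%E.
  by apply: integral_ge0 => x _; exact: (J0 (x, y)).
apply: (@le_trans _ _ (\int[mu]_(y in X)
    ((2 * A)%:E * \int[mu]_(x in X) (nc (G x y) ^+ 2 * nc (a x))%:E))%E).
  apply: ae_ge0_le_integral => //.
  - by move=> y _; rewrite lee_fin sqr_ge0.
  - exact: measurable_normc2.
  - by move=> y _; rewrite mule_ge0 // lee_fin mulr_ge0.
  - exact: emeasurable_funM.
  - by apply: filterS iK => y iy Xy; apply: key => //; exact: iy.
rewrite ge0_integralZl //; last by rewrite lee_fin mulr_ge0.
rewrite (tonelli_prod mX mJ J0).
have -> : (2 * (A ^+ 2 * g ^+ 2))%:E = ((2 * A)%:E * (A * g ^+ 2)%:E)%E.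
  by rewrite -EFinM; congr EFin; ring.
apply: lee_wpmul2l; first by rewrite lee_fin mulr_ge0.
apply: (@le_trans _ _ (\int[mu]_(x in X) ((g ^+ 2)%:E * (nc (a x))%:E))%E).
  apply: ge0_le_integral => //.
  - by move=> x _; apply: integral_ge0 => y _; exact: (J0 (x, y)).
  - exact: (measurable_integral_prod1 mX (H := fun z => (nc (G z.2 z.1) ^+ 2 * nc (a z.2))%:E)
      (measurable_swap_prod mX mJ)).
  - by apply: emeasurable_funM => //; exact/measurable_EFinP.
  (* Where [a x = 0] no bound on the remainder is available, but the integrand vanishes. *)
  - move=> x Xx; have [->|ax0] := eqVneq (a x) 0.
      rewrite (eq_integral (cst 0%E)) ?integral0 => [|y _].
        by rewrite mule_ge0 ?lee_fin ?sqr_ge0 ?normc_ge0.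
      by rewrite /nc Normc.normc0 mulr0.
    rewrite (eq_integral (fun y => (nc (a x))%:E * (nc (G x y) ^+ 2)%:E)%E); last first.
      by move=> y _; rewrite -EFinM mulrC.
    rewrite ge0_integralZl //; last 3 first.
    + by apply/measurable_EFinP; exact: (measurable_section mX
        (H := fun z => nc (G z.1 z.2) ^+ 2) Xx mG2).
    + by move=> y _; rewrite lee_fin sqr_ge0.
    + by rewrite lee_fin normc_ge0.
    by rewrite muleC; apply: lee_wpmul2r; [rewrite lee_fin normc_ge0|exact: bound].
rewrite ge0_integralZl //; last 3 first.
- exact/measurable_EFinP.
- by move=> x _; rewrite lee_fin normc_ge0.
- by rewrite lee_fin sqr_ge0.
rewrite (mulrC A) (EFinM (g ^+ 2)); apply: lee_wpmul2l => //.
by rewrite lee_fin sqr_ge0.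
Qed.

(** * Atoms *)

Lemma integral_support (R : realType) (d : nat) (D : set 'rV[R]_d)
    (f : 'rV[R]_d -> \bar R) : (forall x, ~ D x -> f x = 0%E) ->
  (\int[lebesgue_rV R d]_(x in D) f x = \int[lebesgue_rV R d]_x f x)%E.
Proof.
move=> f0; rewrite integral_mkcond; apply: eq_integral => x _; rewrite /patch.
by case: ifPn => // /negP xD; rewrite f0 // => Dx; apply: xD; exact: mem_set.
Qed.

Lemma cintegral_support (R : realType) (d : nat) (D : set 'rV[R]_d)
    (f : 'rV[R]_d -> R[i]) : (forall x, ~ D x -> f x = 0) ->
  cintegral D f = cintegral setT f.
Proof.
by move=> f0; rewrite /cintegral /Rintegral; congr Complex; congr fine;
  apply: integral_support => x /f0 ->.
Qed.

Section atom_estimates.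
Variables (R : realType) (d : nat).
Local Notation mu := (lebesgue_rV R d).
Local Notation nc := (@Normc.normc R).
Local Notation E := 'rV[R]_d.

(** The counterpart of [powR_le_weighted] for exponents at least 2: for [c > b], [2 - r <= 0] gives
    [c^(2-r) <= b^(2-r)]. *)
Lemma sqr_le_powR (c b r : R) : 0 <= c -> 0 < b -> 2 <= r ->
  c ^+ 2 <= b ^+ 2 + b `^ (2 - r) * c `^ r.
Proof.
move=> c0 b0 r2; have [cb|bc] := leP c b.
  apply: (@le_trans _ _ (b ^+ 2)); first by rewrite ler_pXn2r ?nnegrE ?(ltW b0).
  by rewrite lerDl mulr_ge0 ?powR_ge0.
have c1 : 0 < c by apply: lt_trans bc.
apply: (@le_trans _ _ (b `^ (2 - r) * c `^ r)); last by rewrite lerDr sqr_ge0.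
have -> : c ^+ 2 = c `^ (2 - r) * c `^ r.
  by rewrite -powR_mulrn // -powRD ?subrK // lt0r_neq0 ?implybT.
have e x : x `^ (2 - r) = (x `^ (r - 2))^-1 by rewrite -powRN opprB.
rewrite ler_wpM2r ?powR_ge0 // !e lef_pV2 ?posrE ?powR_gt0 //.
by apply: ge0_ler_powR; rewrite ?nnegrE ?(ltW b0) ?(ltW bc) ?subr_ge0 ?(ltW c1).
Qed.

(* With [b = V^(-1/p)], the bound [c^2 <= b^2 + b^(2-q) c^q] integrated over [B]
   does the work of Hoelder's inequality up to a constant. *)
Lemma atom_norm_le (p : R) (q : \bar R) (a : E -> R[i]) (B : set E) (V : R) :
  0 < p -> (2%:E <= q)%E -> measurable B -> mu B = V%:E -> 0 < V ->
  cmeasurable setT a -> (forall x, ~ B x -> a x = 0) ->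
  (cLnorm q setT a <= mu B `^ ((fine q)^-1 - p^-1))%E ->
  (\int[mu]_x (nc (a x) ^+ 2)%:E <= (2 * V `^ (1 - 2 / p))%:E)%E /\
  (\int[mu]_x (nc (a x))%:E <= (3 * V `^ (1 - 1 / p))%:E)%E.
Proof.
move=> p0 q2 mB BV V0 ma aB.
pose b := V `^ (- p^-1); have b0 : 0 < b by rewrite powR_gt0.
have mna : measurable_fun setT (fun x => nc (a x)) by exact: measurable_normc.
have Vb (t : R) : b `^ t * V = V `^ (1 - t / p).
  rewrite /b -powRrM -{2}(powRr1 (ltW V0)) -powRD ?(lt0r_neq0 V0) ?implybT //.
  by congr (_ `^ _); ring.
have Vb2 : b ^+ 2 * V = V `^ (1 - 2 / p) by rewrite -Vb powR_mulrn // ltW.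
have Vb1 : b * V = V `^ (1 - 1 / p) by rewrite -Vb powRr1 // ltW.
have supp (f : E -> R) : (forall x, a x = 0 -> f x = 0) ->
    (\int[mu]_x (f x)%:E = \int[mu]_(x in B) (f x)%:E)%E.
  by move=> f0; rewrite -(@integral_support _ _ B) // => x /aB /f0 ->.
have aR : cmeasurable B a.
  by case: ma => ma1 ma2; split; exact: measurable_funTS.
have icst (c : R) : (\int[mu]_(x in B) c%:E = c%:E * V%:E)%E.
  by rewrite integral_cst //; congr (_ * _)%E; exact: BV.
have mnaB : measurable_fun B (fun x => nc (a x)) by exact: measurable_normc.
move=> aq; have sq : (\int[mu]_x (nc (a x) ^+ 2)%:E <= (2 * V `^ (1 - 2 / p))%:E)%E.
  rewrite supp; last by move=> x ->; rewrite Normc.normc0 expr0n.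
  case: q q2 aq => [r| |] //=.
  - rewrite lee_fin => r2; have r0 : 0 < r by apply: lt_le_trans r2.
    rewrite BV poweR_EFin => /(@gt0_ler_poweR R r (ltW r0)).
    rewrite !in_itv /= !leey !andbT Lnorm_ge0 lee_fin powR_ge0 => /(_ isT isT).
    rewrite poweR_Lnorm ?lt0r_neq0 // -powRrM.
    have -> : (\int[mu]_x (`|((fun x0 => (nc (a x0))%:E) \_ setT) x| `^ r) =
               \int[mu]_(x in B) (nc (a x) `^ r)%:E)%E.
      rewrite -supp; last by move=> x ->; rewrite Normc.normc0 powR0 // lt0r_neq0.
      apply: eq_integral => x _; rewrite patch_setT /= ger0_norm ?normc_ge0 //.
    move=> h.
    apply: (@le_trans _ _ (\int[mu]_(x in B)
        ((b ^+ 2)%:E + (b `^ (2 - r))%:E * (nc (a x) `^ r)%:E))%E).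
      apply: ge0_le_integral => //.
      + by move=> x _; rewrite lee_fin sqr_ge0.
      + exact: measurable_normc2.
      + apply: emeasurable_funD => //; apply: emeasurable_funM => //.
        by apply/measurable_EFinP; exact: (measurableT_comp (measurable_powR _)).
      + by move=> x _; rewrite -EFinM -EFinD lee_fin; apply: sqr_le_powR => //; exact: normc_ge0.
    have mr : measurable_fun B (fun x => (nc (a x) `^ r)%:E).
      by apply/measurable_EFinP; exact: (measurableT_comp (measurable_powR _)).
    rewrite ge0_integralD //; last 3 first.
    + by move=> x _; rewrite lee_fin sqr_ge0.
    + by move=> x _; rewrite -EFinM lee_fin mulr_ge0 ?powR_ge0.
    + exact: emeasurable_funM.
    rewrite icst ge0_integralZl //; last 2 first.
    + by move=> x _; rewrite lee_fin powR_ge0.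
    + by rewrite lee_fin powR_ge0.
    apply: (@le_trans _ _ ((b ^+ 2)%:E * V%:E +
        (b `^ (2 - r))%:E * (V `^ ((r^-1 - p^-1) * r))%:E)%E).
      by rewrite leeD2l // lee_wpmul2l // lee_fin powR_ge0.
    rewrite -!EFinM -EFinD lee_fin -Vb2.
    have -> : V `^ ((r^-1 - p^-1) * r) = b `^ r * V.
      by rewrite Vb; congr (_ `^ _); field; rewrite ?lt0r_neq0.
    have e : b `^ (2 - r) * b `^ r = b ^+ 2.
      by rewrite -powRD ?(lt0r_neq0 b0) ?implybT // subrK powR_mulrn // ltW.
    by rewrite [X in _ + X]mulrA e mulr2n mulrDl mul1r.
  (* For [q = +oo] the exponent [(fine q)^-1 - 1/p] is [-1/p], so the norm condition reads
     [|a| <= b] almost everywhere. *)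
  - move=> _; rewrite invr0 sub0r BV poweR_EFin -/b => h.
    have ab : \forall x \ae mu, nc (a x) <= b.
      (* The [L^oo] norm is the essential supremum when the whole space has positive measure, as it
         does here since it contains [B]. *)
      move: h; rewrite /cLnorm unlock ifT; last first.
        apply: (@lt_le_trans _ _ (mu B)); first by rewrite BV lte_fin.
        by apply: le_measure => //; exact: mem_set.
      move/ess_sup_inf.ess_supP; apply: filterS => x; rewrite /= patch_setT /=.
      by rewrite ger0_norm ?normc_ge0 // lee_fin.
    apply: (@le_trans _ _ (\int[mu]_(x in B) (b ^+ 2)%:E)%E).
      apply: ae_ge0_le_integral => //.
      + by move=> x _; rewrite lee_fin sqr_ge0.
      + exact: measurable_normc2.
      + by move=> x _; rewrite lee_fin sqr_ge0.
      + apply: filterS ab => x h1 _; rewrite lee_fin.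
        by rewrite ler_pXn2r ?nnegrE ?normc_ge0 ?(ltW b0).
    rewrite icst -EFinM lee_fin Vb2.
    by rewrite ler_peMl ?powR_ge0 // ler1n.
split => //.
rewrite supp; last by move=> x ->; rewrite Normc.normc0.
rewrite supp in sq; last by move=> x ->; rewrite Normc.normc0 expr0n.
(* The [L^1] bound follows from the square bound by [c <= b + c^2 / b]. As [b V = V^(1 - 1/p)], the
   constant is [1 + 2 = 3]. *)
apply: (@le_trans _ _ (\int[mu]_(x in B) (b%:E + (b^-1)%:E * (nc (a x) ^+ 2)%:E))%E).
  apply: ge0_le_integral => //.
  - by move=> x _; rewrite lee_fin normc_ge0.
  - exact/measurable_EFinP.
  - by apply: emeasurable_funD => //; apply: emeasurable_funM => //; exact: measurable_normc2.
  - move=> x _; rewrite -EFinM -EFinD lee_fin.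
    rewrite -(ler_pM2l b0) mulrDr mulrA divff ?lt0r_neq0 // mul1r.
    by have := sqr_ge0 (b - nc (a x)); have := normc_ge0 (a x); nra.
rewrite ge0_integralD //; last 3 first.
- by move=> x _; rewrite lee_fin ltW.
- by move=> x _; rewrite -EFinM lee_fin mulr_ge0 ?invr_ge0 ?sqr_ge0 ?(ltW b0).
- by apply: emeasurable_funM => //; exact: measurable_normc2.
rewrite icst ge0_integralZl //; last 3 first.
- exact: measurable_normc2.
- by move=> x _; rewrite lee_fin sqr_ge0.
- by rewrite lee_fin invr_ge0 ltW.
apply: (@le_trans _ _ (b%:E * V%:E + (b^-1)%:E * (2 * V `^ (1 - 2 / p))%:E)%E).
  by rewrite leeD2l // lee_wpmul2l // lee_fin invr_ge0 ltW.
rewrite -!EFinM -EFinD lee_fin -Vb2 -Vb1 le_eqVlt; apply/orP; left; apply/eqP.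
by field; rewrite lt0r_neq0.
Qed.

End atom_estimates.

Section moments.
Variables (R : realType) (d : nat) (B : set 'rV[R]_d) (a : 'rV[R]_d -> R[i]).
Local Notation mu := (lebesgue_rV R d).
Local Notation nc := (@Normc.normc R).
Local Notation E := 'rV[R]_d.

(** A shifted monomial as a list of linear factors, to be expanded one factor at a time. *)
Definition shifted_prod (x' : E) (l : seq 'I_d) (x : E) : R :=
  \prod_(i <- l) (x ord0 i - x' ord0 i).

Lemma monomial_shift (x' x : E) (n : {ffun 'I_d -> nat}) :
  monomial n (x - x') =
  shifted_prod x' (flatten [seq nseq (n i) i | i <- enum 'I_d]) x.
Proof.
rewrite /shifted_prod big_flatten big_map /monomial big_enum /=.
by apply: eq_bigr => i _; rewrite big_nseq iter_mulr_1 !mxE.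
Qed.

Lemma size_shift (n : {ffun 'I_d -> nat}) :
  size (flatten [seq nseq (n i) i | i <- enum 'I_d]) = mdeg n.
Proof.
rewrite size_flatten /shape -map_comp sumnE big_map /mdeg big_enum /=.
by apply: eq_bigr => i _; rewrite size_nseq.
Qed.

Definition midx_incr (n : {ffun 'I_d -> nat}) (i : 'I_d) : {ffun 'I_d -> nat} :=
  [ffun j => n j + (j == i)]%N.

Lemma mdeg_incr n i : mdeg (midx_incr n i) = (mdeg n).+1.
Proof.
rewrite /mdeg (eq_bigr (fun j => n j + (j == i))%N); last by move=> j _; rewrite ffunE.
rewrite big_split /= (bigD1 i (F := fun j => (j == i) : nat)) //= eqxx.
by rewrite [X in (_ + (_ + X))%N]big1 ?addn0 ?addn1 // => j /negbTE ->.
Qed.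

Lemma monomial_incr n i (x : E) :
  monomial (midx_incr n i) x = x ord0 i * monomial n x.
Proof.
rewrite /monomial (eq_bigr (fun j => x ord0 j ^+ n j * x ord0 j ^+ (j == i))); last first.
  by move=> j _; rewrite ffunE exprD.
rewrite big_split /= mulrC; congr (_ * _).
by rewrite (bigD1 i) //= eqxx expr1 big1 ?mulr1 // => j /negbTE ->; rewrite expr0.
Qed.

Lemma measurable_monomial n : measurable_fun setT (monomial n : E -> R).
Proof.
apply: measurable_prod => i _; apply: measurable_funX; exact: measurable_coor.
Qed.

Lemma measurable_shifted_prod x' l : measurable_fun setT (shifted_prod x' l).
Proof.
apply: measurable_prod => i _; apply: measurable_funB => //; exact: measurable_coor.
Qed.

Hypothesis mB : measurable B.
Hypothesis ma : cmeasurable setT a.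
Hypothesis aB : forall x, ~ B x -> a x = 0.
Hypothesis aint : (\int[mu]_x (nc (a x))%:E < +oo)%E.

Lemma cintegrable_bounded_mul (X : set E) (f : E -> R) (M : R) : measurable X ->
  measurable_fun setT f -> (forall x, B x -> `|f x| <= M) ->
  cintegrable X (fun x => a x * (f x)%:C%C).
Proof.
move=> mX mf fM.
have maX : cmeasurable X a by case: ma => ma1 ma2; split; exact: measurable_funTS.
apply: (@cintegrable_le _ _ _ mX _ (fun x => `|M| * nc (a x))).
- by apply: cmeasurableM => //; split => //=; exact: measurable_funTS.
- move=> x _; rewrite Normc.normcM normcR mulrC.
  have [Bx|/aB ->] := pselect (B x); last by rewrite Normc.normc0 !mulr0.
  by rewrite ler_wpM2r ?normc_ge0 // (le_trans (fM x Bx)) // ler_norm.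
- apply: (integrableZl mX `|M| (f := fun x => (nc (a x))%:E)).
  apply: (@integrableS _ _ _ _ setT) => //.
  apply/integrableP; split; first by apply/measurable_EFinP; exact: measurable_normc.
  by under eq_integral do rewrite /= ger0_norm ?normc_ge0 //.
Qed.

Hypothesis Bbd : exists M : R, forall x i, B x -> `|x ord0 i| <= M.

Lemma bounded_shifted_prod x' l n : exists M : R, forall x, B x ->
  `|shifted_prod x' l x * monomial n x| <= M.
Proof.
have [M BM] := Bbd.
exists ((\prod_(i <- l) (M + `|x' ord0 i|)) * \prod_(i < d) M ^+ n i) => x Bx.
rewrite normrM; apply: ler_pM => //.
  rewrite /shifted_prod normr_prod; apply: ler_prod => i _; rewrite normr_ge0 /=.
  by apply: le_trans (ler_normB _ _) _; rewrite lerD2r BM.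
rewrite /monomial normr_prod; apply: ler_prod => i _; rewrite normr_ge0 /= normrX.
have M0 : 0 <= M by apply: le_trans (BM x i Bx).
by rewrite lerXn2r ?nnegrE // BM.
Qed.

(* The extra monomial makes the induction on [l] possible: multiplying by
   [x_i - x'_i] yields the cases [n + e_i] and [n]. *)
Lemma moment_shifted_prod (P : nat) x' l n :
  (forall n, (mdeg n <= P)%N -> cintegral B (fun x => a x * (monomial n x)%:C%C) = 0) ->
  (size l + mdeg n <= P)%N ->
  cintegral setT (fun x => a x * (shifted_prod x' l x * monomial n x)%:C%C) = 0.
Proof.
move=> mom; elim: l n => [|i l IH] n /= lP.
  rewrite -(mom n) // (@cintegral_support _ _ B) => [|x /aB ->]; last by rewrite mul0r.
  by congr cintegral; apply/funext => x; rewrite /shifted_prod big_nil mul1r.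
have mm m : measurable_fun setT (fun x => shifted_prod x' l x * monomial m x).
  by apply: measurable_funM; [exact: measurable_shifted_prod|exact: measurable_monomial].
have int m : cintegrable setT (fun x => a x * (shifted_prod x' l x * monomial m x)%:C%C).
  have [M bM] := bounded_shifted_prod x' l m.
  exact: cintegrable_bounded_mul bM.
transitivity (cintegral setT (fun x =>
    a x * (shifted_prod x' l x * monomial (midx_incr n i) x)%:C%C +
    (- x' ord0 i)%:C%C * (a x * (shifted_prod x' l x * monomial n x)%:C%C))).
  congr cintegral; apply/funext => x.
  rewrite /shifted_prod big_cons -/(shifted_prod x' l x) monomial_incr.
  by rewrite !(rmorphM, rmorphB, rmorphN) /=; ring.
rewrite cintegralD //; last exact: cintegrableZ.
rewrite cintegralZ // IH; last by rewrite mdeg_incr addnS -addSn.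
by rewrite IH ?mulr0 ?addr0 //; exact: leq_trans (leqnSn _) lP.
Qed.

(** Atoms have vanishing moments about the origin, whereas the Taylor polynomial is centred at [x'].
    Since [a] vanishes outside [B] and outside [X], the integrals over [B], [X] and the whole space
    agree. *)
Lemma moment_monomial_shift (P : nat) x' n (X : set E) : measurable X ->
  (forall x, ~ X x -> a x = 0) ->
  (forall n, (mdeg n <= P)%N -> cintegral B (fun x => a x * (monomial n x)%:C%C) = 0) ->
  (mdeg n <= P)%N ->
  cintegrable X (fun x => a x * (monomial n (x - x'))%:C%C) /\
  cintegral X (fun x => a x * (monomial n (x - x'))%:C%C) = 0.
Proof.
move=> mX aX mom nP; pose l := flatten [seq nseq (n i) i | i <- enum 'I_d].
pose z : {ffun 'I_d -> nat} := [ffun=> 0%N].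
have z1 x : monomial z x = 1 :> R.
  by rewrite /monomial big1 // => i _; rewrite ffunE.
have z0 : mdeg z = 0%N by rewrite /mdeg big1 // => i _; rewrite ffunE.
have e : (fun x => a x * (monomial n (x - x'))%:C%C) =
    (fun x => a x * (shifted_prod x' l x * monomial z x)%:C%C).
  by apply/funext => x; rewrite monomial_shift z1 mulr1.
rewrite e; split.
  have [M bM] := bounded_shifted_prod x' l z.
  apply: cintegrable_bounded_mul bM => //.
  by apply: measurable_funM; [exact: measurable_shifted_prod|exact: measurable_monomial].
rewrite cintegral_support => [|x /aX ->]; last by rewrite mul0r.
by apply: moment_shifted_prod mom _; rewrite size_shift z0 addn0.
Qed.

End moments.

Section atom_coefficients.
Variables (R : realType) (d : nat) (p : R) (q : \bar R) (X : set 'rV[R]_d).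
Variable phi : {ffun 'I_d -> nat} -> 'rV[R]_d -> R[i].
Local Notation mu := (lebesgue_rV R d).
Local Notation nc := (@Normc.normc R).
Local Notation E := 'rV[R]_d.
Local Notation P := (Num.truncn (d%:R * (p^-1 - 1))).
Hypotheses (p0 : 0 < p) (q2 : (2%:E <= q)%E) (oX : open X).
Hypothesis onb : orthonormal_basis X phi.

Definition taylor_remainder (K : E -> E -> R[i]) (k : nat) (x x' y : E) : R[i] :=
  K x y - midx_sum k (fun n => cmderive n (fun z => K z y) x' / (mfact n)%:R
                        * (monomial n (x - x'))%:C%C).

Variables (a : E -> R[i]) (c : E) (rho V : R).
Hypotheses (V0 : 0 < V) (BV : mu (eball c rho) = V%:E).
Hypothesis ma : cmeasurable setT a.
Hypothesis aX : forall x, ~ X x -> a x = 0.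
Hypothesis aB : forall x, ~ eball c rho x -> a x = 0.
Hypothesis aq : (cLnorm q setT a <= mu (eball c rho) `^ ((fine q)^-1 - p^-1))%E.
Hypothesis a_moment : forall n : {ffun 'I_d -> nat}, (mdeg n <= P)%N ->
  cintegral (eball c rho) (fun x => a x * (monomial n x)%:C%C) = 0.

Let mX : measurable X := measurable_rV_open oX.

Let maX : cmeasurable X a.
Proof. by case: ma => ma1 ma2; split; exact: measurable_funTS. Qed.

Let norms := atom_norm_le p0 q2 (measurable_eball c rho) BV V0 ma aB aq.

Lemma atom_L2_le : (\int[mu]_(x in X) (nc (a x) ^+ 2)%:E <= (2 * V `^ (1 - 2 / p))%:E)%E.
Proof.
rewrite integral_support; first exact: norms.1.
by move=> x /aX ->; rewrite Normc.normc0 expr0n.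
Qed.

Lemma atom_L1_le : (\int[mu]_(x in X) (nc (a x))%:E <= (3 * V `^ (1 - 1 / p))%:E)%E.
Proof.
rewrite integral_support; first exact: norms.2.
by move=> x /aX ->; rewrite Normc.normc0.
Qed.

Lemma atom_inL2 : inL2 X a.
Proof.
apply: inL2_integrable => //; apply/integrableP; split; first exact: measurable_normc2.
under eq_integral do rewrite /= ger0_norm ?sqr_ge0 //.
by apply: le_lt_trans atom_L2_le _; exact: ltry.
Qed.

Lemma atom_coef_sum_le N :
  \sum_(n <- box d N) nc (L2dot X a (phi n)) ^+ 2 <= 4 * V `^ (1 - 2 / p).
Proof.
rewrite -lee_fin.
apply: le_trans (onb_coef_le mX onb N maX (onb_complete onb atom_inL2)) _.
apply: le_trans (lee_wpmul2l _ atom_L2_le) _ => //.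
by rewrite -EFinM lee_fin mulrA -natrM.
Qed.

Lemma atom_smoothed_coef_sum_le (K : E -> E -> R[i]) (r g : R) N :
  0 <= g -> is_integral_kernel X phi r K ->
  (forall y, X y -> cCn P X (fun x => K x y)) ->
  (forall x x', X x -> X x' -> enorm (x - x') < 2 * rho ->
    (cLnorm 2%:E X (taylor_remainder K P x x') <= g%:E)%E) ->
  \sum_(n <- box d N) nc ((r ^+ mdeg n)%:C%C * L2dot X a (phi n)) ^+ 2
    <= 4 * ((3 * V `^ (1 - 1 / p)) ^+ 2 * g ^+ 2).
Proof.
move=> g0 [[mK1 mK2] iK] smK remK.
set A := 3 * _; have A0 : 0 <= A by rewrite mulr_ge0 ?powR_ge0.
(* The centre [c] of the ball may lie outside [X], so the Taylor expansion is centred at a point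
   where [a] is nonzero; such a point lies both in [X] and in the ball. *)
have [a0|/existsNP[x' ax']] := pselect (forall x, a x = 0).
  rewrite big1 => [|n _]; first by rewrite mulr_ge0 // mulr_ge0 // sqr_ge0.
  rewrite (_ : L2dot X a (phi n) = 0) ?mulr0 ?Normc.normc0 ?expr0n //.
  by rewrite (_ : a = fun=> 0) ?L2dot0l //; apply/funext.
have Xx' : X x' by apply: contrapT => /aX.
have Bx' : eball c rho x' by apply: contrapT => /aB.
have [iKa cvK] := iK a atom_inL2.
rewrite -lee_fin.
apply: le_trans (onb_coef_le mX onb N _ cvK) _.
  exact: measurable_cintegral_kernel.
have -> : (4 * (A ^+ 2 * g ^+ 2))%:E = (2%:E * (2 * (A ^+ 2 * g ^+ 2))%:E)%E.
  by rewrite -EFinM; congr EFin; ring.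
apply: lee_wpmul2l => //.
(* Cut off to 0 above degree [P]: [integral_kernel_moment_le] quantifies over all indices, while
   measurable derivatives and vanishing moments are available only up to [P]. *)
pose cf n y := if (mdeg n <= P)%N then cmderive n (fun z => K z y) x' / (mfact n)%:R else 0.
pose m n (x : E) : R := if (mdeg n <= P)%N then monomial n (x - x') else 0.
have aint : (\int[mu]_x (nc (a x))%:E < +oo)%E by apply: le_lt_trans norms.2 _; exact: ltry.
have Bbd : exists M : R, forall x i, eball c rho x -> `|x ord0 i| <= M.
  exists (rho + enorm c) => x i xB.
  have -> : x ord0 i = (x - c) ord0 i + c ord0 i by rewrite !mxE subrK.
  apply: le_trans (ler_normD _ _) _; apply: lerD; last exact: coor_le_enorm.
  by apply: le_trans (coor_le_enorm _ _) _; exact: ltW.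
have mom n : (mdeg n <= P)%N ->
    cintegrable X (fun x => a x * (monomial n (x - x'))%:C%C) /\
    cintegral X (fun x => a x * (monomial n (x - x'))%:C%C) = 0.
  exact: (@moment_monomial_shift _ _ (eball c rho)).
apply: (integral_kernel_moment_le (J := box d P) (c := cf) (m := m)) => //.
- move=> n; rewrite /cf; case nP : (mdeg n <= P)%N; last exact: cmeasurable_cst.
  apply: cmeasurableM; last exact: cmeasurable_cst.
  split; rewrite /cmderive /=.
    apply: (@measurable_mderive _ _ _ oX P (fun x y => complex.Re (K x y))) => //.
    split; last by move=> y /smK[].
    by move=> x Xx; exact: (measurable_section mX (H := fun z => complex.Re (K z.1 z.2))).
  apply: (@measurable_mderive _ _ _ oX P (fun x y => complex.Im (K x y))) => //.
  split; last by move=> y /smK[].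
  by move=> x Xx; exact: (measurable_section mX (H := fun z => complex.Im (K z.1 z.2))).
- move=> n; rewrite /m; case nP : (mdeg n <= P)%N; last exact: measurable_cst.
  apply: measurable_funTS; under eq_fun do rewrite monomial_shift.
  exact: measurable_shifted_prod.
- move=> n; rewrite /m; case nP : (mdeg n <= P)%N; first by have [] := mom n nP.
  by under eq_fun do rewrite mulr0; split; exact: integrable0.
- move=> n; rewrite /m; case nP : (mdeg n <= P)%N; first by have [] := mom n nP.
  by under eq_fun do rewrite mulr0; exact: cintegral0.
- exact: atom_L1_le.
- move=> x Xx ax; have Bx : eball c rho x by apply: contrapT => /aB; exact/eqP.
  have := remK x x' Xx Xx' (eball_dist_lt Bx Bx').
  move=> /(cLnorm2_le g0); apply: le_trans; rewrite le_eqVlt; apply/orP; left; apply/eqP.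
  apply: eq_integral => y _; rewrite /taylor_remainder midx_sum_box.
  congr ((nc (_ - _) ^+ 2)%:E); apply: eq_big_seq => n; rewrite mem_box => nP.
  by rewrite /cf /m nP.
Qed.

End atom_coefficients.

(** * Frequency blocks *)

(** Finitely many strict inequalities have a common margin; it is capped by [eta], the decay rate
    that Bessel's inequality provides. *)
Lemma uniform_lower_bound (R : realFieldType) (D : seq R) (nu eta : R) (P : nat) :
  0 < eta -> (forall delta, delta \in D -> 0 < P%:R + delta - nu) ->
  exists a : R, [/\ 0 < a, a <= eta & forall delta, delta \in D -> a <= P%:R + delta - nu].
Proof.
move=> eta0; elim: D => [|x D IH] D0; first by exists eta.
have [delta dD|a [a0 aeta aD]] := IH; first by apply: D0; rewrite inE dD orbT.
exists (Num.min a (P%:R + x - nu)); split.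
- by rewrite lt_min a0 D0 // inE eqxx.
- by rewrite ge_min aeta.
- move=> delta; rewrite inE => /predU1P[->|/aD h]; first by rewrite ge_min lexx orbT.
  by rewrite ge_min h.
Qed.

(** Bernoulli's inequality at the exponent [2^(k+1)] would give only 0. At half of it, it gives 1/2,
    and squaring yields 1/4. *)
Lemma bernoulli_pow2_ge (R : realFieldType) (k j : nat) : (j < 2 ^ k.+1)%N ->
  4^-1 <= (1 - (2 ^+ k.+1)^-1 : R) ^+ j.
Proof.
move=> jk; set x := (2 ^+ k.+1)^-1 : R.
have x0 : 0 <= x by rewrite invr_ge0 exprn_ge0.
have x1 : x <= 2^-1.
  by rewrite lef_pV2 ?posrE ?exprn_gt0 // exprS ler_peMr // exprn_ege1 // ler1n.
have y0 : 0 <= 1 - x by lra.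
have y1 : 1 - x <= 1 by lra.
have bern n : 1 - n%:R * x <= (1 - x) ^+ n.
  elim: n => [|n IH]; first by rewrite mul0r subr0.
  rewrite exprS; apply: (@le_trans _ _ ((1 - x) * (1 - n%:R * x))).
    have := mulr_ge0 (mulr_ge0 (ler0n R n) x0) x0.
    rewrite -natr1; nra.
  by rewrite ler_wpM2l.
have half : 2^-1 <= (1 - x) ^+ (2 ^ k).
  apply: le_trans (bern _); rewrite /x natrX exprS invfM mulrCA divff ?mulr1 ?expf_neq0 //.
  lra.
apply: (@le_trans _ _ ((1 - x) ^+ (2 ^ k.+1))); last by rewrite ler_wiXn2l // ltnW.
rewrite expnS mulnC exprM; apply: (@le_trans _ _ (2^-1 ^+ 2)); first lra.
by rewrite ler_pXn2r ?nnegrE ?exprn_ge0 // invr_ge0.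
Qed.

Lemma powR_ge_one (R : realType) (x t : R) : 1 <= x -> 0 <= t -> 1 <= x `^ t.
Proof. by move=> x1 t0; rewrite -[leLHS](powRr0 x) ler_powR. Qed.

Section frequency_blocks.
Variables (R : realType) (d : nat) (p gamma : R) (D : seq R).
Let nu := d%:R * (p^-1 - 1).
Let P := Num.truncn nu.
Let kappa := (2 - p) * d%:R * gamma / p.
Let eta := d%:R * (p^-1 - 2^-1).
Hypotheses (d0 : (0 < d)%N) (p0 : 0 < p) (p1 : p <= 1) (g0 : 0 < gamma).
Variables (a C : R).
Hypotheses (a0 : 0 < a) (aeta : a <= eta) (C0 : 0 <= C).
Hypothesis aD : forall delta, delta \in D -> a <= P%:R + delta - nu.

(** The assumed remainder estimate for [k = P] at distance [2 rho], the diameter of the ball. *)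
Definition remainder_bound (r rho : R) : R :=
  C * \sum_(delta <- D)
    (1 - r) `^ (- (d%:R + 2 * P%:R + 2 * delta) * gamma) * (2 * rho) `^ (P%:R + delta).

Let c1 : R := d%:R^-1 *+ 2.

(** The first summand serves Bessel's bound, where [4^(2 eta + 2 a)] pays for large balls with
    [1/4 <= u < 1]. In the second, [24^2 = 16 * 4 * 9]: 16 undoes the smoothing, 4 comes from
    [atom_smoothed_coef_sum_le] and 9 from the [L^1] norm of the atom; [2^(P + delta)] comes from
    the diameter. *)
Definition block_const : R :=
  4 * (c1 `^ (d%:R * (1 - 2 / p)) * 4 `^ (2 * eta + 2 * a)) +
  (24 * (c1 `^ (- nu) * (C * \sum_(delta <- D) 2 `^ (P%:R + delta)))) ^+ 2.

Lemma block_const_ge0 : 0 <= block_const.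
Proof.
apply: addr_ge0; first by apply: mulr_ge0 => //; rewrite mulr_ge0 ?powR_ge0.
exact: sqr_ge0.
Qed.

Let dR : 0 < d%:R :> R. Proof. by rewrite ltr0n. Qed.
Let c10 : 0 < c1. Proof. by rewrite /c1 pmulrn_lgt0 // invr_gt0. Qed.

(** For nonpositive exponents the inscribed cube, of side [c1 * rho], gives an upper bound. *)
Lemma volume_powR_le (V rho t : R) : 0 < rho -> (rho / d%:R *+ 2) ^+ d <= V ->
  t <= 0 -> V `^ t <= c1 `^ (d%:R * t) * rho `^ (d%:R * t).
Proof.
move=> r0 rV t0.
have e : rho / d%:R *+ 2 = c1 * rho by rewrite /c1 mulrnAl mulrC.
have b0 : 0 < (c1 * rho) ^+ d by rewrite exprn_gt0 // mulr_gt0.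
rewrite -powRM ?(ltW c10) ?(ltW r0) // powRrM powR_mulrn ?mulr_ge0 ?(ltW c10) ?(ltW r0) //.
rewrite e in rV.
have eN x : x `^ t = (x `^ (- t))^-1 by rewrite -powRN opprK.
have V0 : 0 < V by apply: lt_le_trans rV.
rewrite !eN lef_pV2 ?posrE ?powR_gt0 //.
by apply: ge0_ler_powR; rewrite ?nnegrE ?oppr_ge0 ?(ltW b0) ?(ltW V0).
Qed.

Lemma block_energy_le (V rho : R) (k : nat) (c : {ffun 'I_d -> nat} -> R) :
  let M := 2 ^+ k.+1 in let u := M `^ (2 * gamma) * rho in
  0 < rho -> (rho / d%:R *+ 2) ^+ d <= V ->
  (forall N, \sum_(n <- box d N) c n ^+ 2 <= 4 * V `^ (1 - 2 / p)) ->
  (rho <= 4^-1 -> forall r N, 0 < r -> r < 1 ->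
    \sum_(n <- box d N) (r ^+ mdeg n * c n) ^+ 2 <=
    4 * ((3 * V `^ (1 - 1 / p)) ^+ 2 * remainder_bound r rho ^+ 2)) ->
  \sum_(n <- box d (2 ^ k.+1).-1) c n ^+ 2
    <= block_const * M `^ (2 * kappa) * (Num.min u u^-1 `^ a) ^+ 2.
Proof.
move=> M u r0 rV H1 H2.
have M2 : 2 <= M by rewrite /M exprS ler_peMr // exprn_ege1 // ler1n.
have M0 : 0 < M by apply: lt_le_trans M2.
have M1 : 1 <= M by apply: le_trans M2; rewrite ler1n.
have u0 : 0 < u by rewrite mulr_gt0 ?powR_gt0.
have ru : rho <= u.
  by rewrite ler_peMl ?(ltW r0) // powR_ge_one // mulr_ge0 // ltW.
have pn0 : p != 0 by rewrite lt0r_neq0.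
have V0 : 0 < V.
  by apply: lt_le_trans rV; rewrite exprn_gt0 // pmulrn_lgt0 // divr_gt0.
have sqm t : (t `^ a) ^+ 2 = t `^ (2 * a).
  by rewrite -powR_mulrn ?powR_ge0 // -powRrM mulrC.
have powu t : rho `^ t = M `^ (- (2 * gamma) * t) * u `^ t.
  rewrite /u powRM ?powR_ge0 ?(ltW r0) // mulrA -powRrM -powRD ?(lt0r_neq0 M0) ?implybT //.
  by rewrite mulNr addNr powRr0 mul1r.
have A1 : \sum_(n <- box d (2 ^ k.+1).-1) c n ^+ 2 <=
    4 * (c1 `^ (d%:R * (1 - 2 / p)) * (M `^ (2 * kappa) * u `^ (- (2 * eta)))).
  apply: le_trans (H1 _) _; rewrite ler_pM2l //.
  have t0 : 1 - 2 / p <= 0 by rewrite subr_le0 ler_pdivlMr // mul1r (le_trans p1) // ler1n.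
  apply: le_trans (volume_powR_le r0 rV t0) _.
  rewrite powu le_eqVlt; apply/orP; left; apply/eqP; congr (_ * (_ `^ _ * _ `^ _)).
    by rewrite /kappa; field.
  by rewrite /eta; field.
have m0 : 0 <= M `^ (2 * kappa) by exact: powR_ge0.
have a20 : 0 <= 2 * a by apply: mulr_ge0 => //; exact: ltW.
have e0 : 0 <= 2 * eta.
  by apply: mulr_ge0 => //; exact: le_trans (ltW a0) aeta.
have four1 : 1 <= 4 `^ (2 * eta + 2 * a) :> R.
  by rewrite powR_ge_one ?ler1n // addr_ge0.
rewrite sqm.
pose mm := Num.min u u^-1 `^ (2 * a).
have mm0 : 0 <= mm by exact: powR_ge0.
have caseA : u `^ (- (2 * eta)) <= 4 `^ (2 * eta + 2 * a) * mm ->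
    \sum_(n <- box d (2 ^ k.+1).-1) c n ^+ 2 <= block_const * M `^ (2 * kappa) * mm.
  move=> h; apply: le_trans A1 _.
  apply: (@le_trans _ _ (4 * (c1 `^ (d%:R * (1 - 2 / p)) * 4 `^ (2 * eta + 2 * a)) *
     M `^ (2 * kappa) * mm)).
    have -> : 4 * (c1 `^ (d%:R * (1 - 2 / p)) * 4 `^ (2 * eta + 2 * a)) * M `^ (2 * kappa) * mm =
      4 * (c1 `^ (d%:R * (1 - 2 / p)) * (M `^ (2 * kappa) * (4 `^ (2 * eta + 2 * a) * mm))).
      by ring.
    by rewrite ler_pM2l // ler_wpM2l ?powR_ge0 // ler_wpM2l.
  by rewrite ler_wpM2r // ler_wpM2r // /block_const lerDl sqr_ge0.
(* Bessel's bound is used for [1 <= u] and for large balls, where [u >= 1/4];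
   the remainder estimate is used for [u < 1] and [rho <= 1/4]. *)
have [u1|u1] := leP 1 u.
  apply: caseA; rewrite /mm min_r; last by apply: le_trans (u1); rewrite invf_le1.
  apply: (@le_trans _ _ (u^-1 `^ (2 * a))); last by rewrite ler_peMl ?powR_ge0.
  rewrite -powR_inv1 ?(ltW u0) // -powRrM mulN1r ler_powR // lerN2.
  by rewrite ler_pM2l.
have uV : u <= u^-1 by rewrite (le_trans (ltW u1)) // invf_ge1 // ltW.
have mmE : mm = u `^ (2 * a) by rewrite /mm min_l.
have [rho4|rho4] := ltP 4^-1 rho.
  apply: caseA; rewrite mmE.
  have u4 : 4^-1 <= u by apply: le_trans ru; exact: ltW.
  have u4V : u^-1 <= 4 by rewrite -[leRHS]invrK lef_pV2 ?posrE.
  have uN t : u `^ (- t) = u^-1 `^ t.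
    by rewrite -(powR_inv1 (ltW u0)) -powRrM mulN1r.
  (* The first factor is at most [4^(2 eta + 2 a)] because [1/u <= 4]. *)
  apply: (@le_trans _ _ (u^-1 `^ (2 * eta + 2 * a) * u `^ (2 * a))).
    rewrite -uN -powRD ?(lt0r_neq0 u0) ?implybT //.
    by rewrite opprD subrK.
  rewrite ler_wpM2r ?powR_ge0 //; apply: ge0_ler_powR; rewrite ?nnegrE ?invr_ge0 ?(ltW u0) //.
  exact: addr_ge0.
pose r := 1 - M^-1.
have r01 : 0 < r by rewrite subr_gt0 invf_lt1 // (lt_le_trans _ M2) // ltr1n.
have r1 : r < 1 by rewrite ltrBlDr ltrDl invr_gt0.
(* On the box [|n| < M], so [r^|n| >= 1/4]; squaring gives the factor 16. *)
apply: (@le_trans _ _ (16 * \sum_(n <- box d (2 ^ k.+1).-1) (r ^+ mdeg n * c n) ^+ 2)).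
  rewrite mulr_sumr big_seq [leRHS]big_seq; apply: ler_sum => n.
  rewrite mem_box -ltnS prednK ?expn_gt0 // => nk.
  rewrite exprMn mulrA ler_peMl ?sqr_ge0 //.
  have := @bernoulli_pow2_ge R k _ nk; rewrite -/M -/r => h.
  apply: (@le_trans _ _ (16 * (4^-1) ^+ 2)); first lra.
  by rewrite ler_pM2l // ler_pXn2r ?nnegrE ?exprn_ge0 ?(ltW r01) // invr_ge0.
have S0 : 0 <= \sum_(delta <- D) 2 `^ (P%:R + delta) :> R.
  by rewrite sumr_ge0 // => delta _; exact: powR_ge0.
have G : V `^ (1 - 1 / p) * remainder_bound r rho <=
    c1 `^ (- nu) * (C * \sum_(delta <- D) 2 `^ (P%:R + delta)) * (M `^ kappa * u `^ a).
  have t0 : 1 - 1 / p <= 0 by rewrite subr_le0 ler_pdivlMr // mul1r.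
  have rb0 : 0 <= remainder_bound r rho.
    by rewrite mulr_ge0 // sumr_ge0 // => delta _; rewrite mulr_ge0 ?powR_ge0.
  apply: le_trans (ler_wpM2r rb0 (volume_powR_le r0 rV t0)) _.
  have -> : d%:R * (1 - 1 / p) = - nu by rewrite /nu; field.
  rewrite /remainder_bound.
  have -> : c1 `^ (- nu) * rho `^ (- nu) * (C * \sum_(delta <- D)
      (1 - r) `^ (- (d%:R + 2 * P%:R + 2 * delta) * gamma) * (2 * rho) `^ (P%:R + delta)) =
      c1 `^ (- nu) * (C * \sum_(delta <- D) rho `^ (- nu) *
      ((1 - r) `^ (- (d%:R + 2 * P%:R + 2 * delta) * gamma) * (2 * rho) `^ (P%:R + delta))).
    by rewrite -mulr_sumr; ring.
  rewrite -!mulrA ler_wpM2l ?powR_ge0 // ler_wpM2l // mulr_suml.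
  rewrite big_seq [leRHS]big_seq; apply: ler_sum => delta dD.
  have -> : 1 - r = M^-1 by rewrite /r opprB addrC subrK.
  rewrite -(powR_inv1 (ltW M0)) -powRrM powRM ?(ltW r0) //.
  have -> : rho `^ (- nu) * (M `^ (-1 * (- (d%:R + 2 * P%:R + 2 * delta) * gamma)) *
     (2 `^ (P%:R + delta) * rho `^ (P%:R + delta))) =
     2 `^ (P%:R + delta) * (M `^ ((d%:R + 2 * P%:R + 2 * delta) * gamma) *
       rho `^ (P%:R + delta - nu)).
    have -> : rho `^ (P%:R + delta - nu) = rho `^ (P%:R + delta) * rho `^ (- nu).
      by rewrite -powRD ?(lt0r_neq0 r0) ?implybT.
    have -> : -1 * (- (d%:R + 2 * P%:R + 2 * delta) * gamma) =
      (d%:R + 2 * P%:R + 2 * delta) * gamma by ring.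
    by ring.
  rewrite ler_wpM2l ?powR_ge0 // powu mulrA -powRD ?(lt0r_neq0 M0) ?implybT //.
  (* The terms in [P] and [delta] cancel, leaving [(d + 2 nu) gamma = kappa]. *)
  have -> : (d%:R + 2 * P%:R + 2 * delta) * gamma + - (2 * gamma) * (P%:R + delta - nu) = kappa.
    by rewrite /kappa /nu; field.
  rewrite ler_wpM2l ?powR_ge0 // ger_powR ?aD // u0 /=.
  exact: ltW.
apply: (@le_trans _ _ ((24 * (V `^ (1 - 1 / p) * remainder_bound r rho)) ^+ 2)).
  have -> : (24 * (V `^ (1 - 1 / p) * remainder_bound r rho)) ^+ 2 =
    16 * (4 * ((3 * V `^ (1 - 1 / p)) ^+ 2 * remainder_bound r rho ^+ 2)) by ring.
  by rewrite ler_pM2l //; exact: H2.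
have Mk : M `^ (2 * kappa) = (M `^ kappa) ^+ 2.
  by rewrite -powR_mulrn ?powR_ge0 // -powRrM mulrC.
rewrite -/mm mmE -sqm Mk.
set S := c1 `^ (- nu) * _ in G.
apply: (@le_trans _ _ ((24 * (S * (M `^ kappa * u `^ a))) ^+ 2)).
  rewrite ler_pXn2r ?nnegrE ?ler_pM2l //.
    rewrite mulr_ge0 // mulr_ge0 ?powR_ge0 // mulr_ge0 // sumr_ge0 // => delta _.
    by rewrite mulr_ge0 ?powR_ge0.
  by rewrite mulr_ge0 // mulr_ge0 // ?mulr_ge0 ?powR_ge0.
have -> : (24 * (S * (M `^ kappa * u `^ a))) ^+ 2 =
  (24 * S) ^+ 2 * (M `^ kappa) ^+ 2 * (u `^ a) ^+ 2 by ring.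
rewrite ler_wpM2r ?sqr_ge0 // ler_wpM2r ?sqr_ge0 //.
by rewrite /block_const -/S lerDr mulr_ge0 // mulr_ge0 ?powR_ge0.
Qed.

End frequency_blocks.

(** * Superposition of atoms *)

(** Dividing the [lambda_j] by [l = L^(1/p)] makes [powR_atomic_sum_le] applicable for each [i].
    After exchanging the sums, each atom contributes at most [mu_j^p C]; homogeneity restores
    [l^s = L^(s/p)]. *)
Lemma superposition_sum_le (R : realType) (I : Type) (r : seq I) (M : nat)
    (lambda : nat -> R[i]) (c : nat -> I -> R[i]) (w : I -> R) (p s C L : R) :
  0 < p -> p <= 1 -> p <= s -> 0 <= C -> (forall i, 0 <= w i) ->
  (forall j, \sum_(i <- r) Normc.normc (c j i) `^ s * w i <= C) ->
  0 <= L -> \sum_(j < M) Normc.normc (lambda j) `^ p <= L ->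
  \sum_(i <- r) Normc.normc (\sum_(j < M) lambda j * c j i) `^ s * w i
    <= C * L `^ (s / p).
Proof.
move=> p0 p1 ps C0 w0 cC L0 sumL.
have s0 : 0 < s by apply: lt_le_trans ps.
have lamp (j : 'I_M) : Normc.normc (lambda j) `^ p <= L.
  apply: le_trans sumL; rewrite (bigD1 j) //= lerDl sumr_ge0 // => i _; exact: powR_ge0.
(* For [L = 0] the normalisation is impossible, but then all [lambda_j] vanish. *)
move: L0; rewrite le_eqVlt => /predU1P[L0|L0].
  have lam0 (j : 'I_M) : lambda j = 0.
    apply: Normc.eq0_normc; have := lamp j; rewrite -L0 => h.
    have /eqP := le_anti (introT andP (conj h (powR_ge0 (Normc.normc (lambda j)) p))).
    by rewrite powR_eq0 => /andP[/eqP].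
  rewrite big1 ?mulr_ge0 ?powR_ge0 // => i _.
  by rewrite big1 ?Normc.normc0 ?powR0 ?mul0r ?lt0r_neq0 // => j _; rewrite lam0 mul0r.
pose l := L `^ p^-1; have l0 : 0 < l by rewrite powR_gt0.
have lp : l `^ p = L by rewrite -powRrM mulVf ?lt0r_neq0 // powRr1 // ltW.
have ls : l `^ s = L `^ (s / p) by rewrite -powRrM mulrC.
pose mu (j : 'I_M) := Normc.normc (lambda j) / l.
have mu0 j : 0 <= mu j by rewrite divr_ge0 ?normc_ge0 // ltW.
have mup j : mu j `^ p = Normc.normc (lambda j) `^ p / L.
  rewrite powRM ?normc_ge0 ?invr_ge0 ?(ltW l0) // -powR_inv1 ?(ltW l0) //.
  by rewrite -powRrM mulN1r powRN lp.
have sum1 : \sum_(j < M) mu j `^ p <= 1.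
  by under eq_bigr do rewrite mup; rewrite -mulr_suml ler_pdivrMr // mul1r.
have mu1 j : mu j <= 1.
  rewrite leNgt; apply/negP => h; have := lamp j.
  rewrite -[leRHS]mul1r -ler_pdivrMr // -mup leNgt => /negP; apply.
  have : 1 `^ p < mu j `^ p by apply: gt0_ltr_powR; rewrite ?nnegrE.
  by rewrite powR1.
apply: (@le_trans _ _ (\sum_(i <- r)
    (l `^ s * \sum_(j < M) mu j `^ p * Normc.normc (c j i) `^ s) * w i)).
  apply: ler_sum => i _; rewrite ler_wpM2r //.
  apply: (@le_trans _ _ ((l * \sum_(j < M) mu j * Normc.normc (c j i)) `^ s)).
    apply: ge0_ler_powR; rewrite ?nnegrE ?normc_ge0 ?(ltW s0) //.
      by rewrite mulr_ge0 ?(ltW l0) // sumr_ge0 // => j _; rewrite mulr_ge0 ?normc_ge0.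
    apply: le_trans (normc_sum _ _) _; rewrite mulr_sumr; apply: ler_sum => j _.
    by rewrite Normc.normcM mulrA /mu mulrCA divff ?mulr1 // lt0r_neq0.
  rewrite powRM ?(ltW l0) //; last first.
    by rewrite sumr_ge0 // => j _; rewrite mulr_ge0 ?normc_ge0.
  rewrite ler_wpM2l ?powR_ge0 //.
  by apply: powR_atomic_sum_le => // j; exact: normc_ge0.
under eq_bigr do rewrite -mulrA; rewrite -mulr_sumr ls mulrC ler_wpM2r ?powR_ge0 //.
under eq_bigr do rewrite mulr_suml; rewrite exchange_big /=.
apply: (@le_trans _ _ (\sum_(j < M) mu j `^ p * C)).
  apply: ler_sum => j _; under eq_bigr do rewrite -mulrA.
  by rewrite -mulr_sumr ler_wpM2l ?powR_ge0.
by rewrite -mulr_suml ler_piMl.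
Qed.

Lemma ccvg_eventually_half (R : realType) (u : nat -> R[i]) (z : R[i]) :
  ccvg u z -> exists M0, forall M, (M0 <= M)%N ->
    Normc.normc z <= 2 * Normc.normc (u M).
Proof.
move=> uz; have [->|z0] := eqVneq z 0.
  by exists 0%N => M _; rewrite Normc.normc0 mulr_ge0 ?normc_ge0.
have nz : 0 < Normc.normc z / 2.
  rewrite divr_gt0 // lt_neqAle normc_ge0 andbT eq_sym.
  by apply/negP => /eqP/Normc.eq0_normc/eqP; exact/negP.
have [M0 _ HM] := cvgr_lt _ uz _ nz.
exists M0 => M /HM /= h.
have : Normc.normc z <= Normc.normc (u M) + Normc.normc (u M - z).
  rewrite -{1}(subrK (u M) z) addrC; apply: le_trans (normcD _ _) _.
  by rewrite lerD2l -normcN opprB.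
lra.
Qed.

(* The partial sums eventually satisfy [|z i| <= 2 |u i M|]; the factor [2^s] makes
   the continuity of the power function unnecessary. *)
Lemma ccvg_sum_le (R : realType) (I : eqType) (r : seq I)
    (u : I -> nat -> R[i]) (z : I -> R[i]) (w : I -> R) (s Z : R) :
  0 <= s -> (forall i, 0 <= w i) ->
  (forall i, z i = 0 \/ ccvg (u i) (z i)) ->
  (forall M, \sum_(i <- r) Normc.normc (u i M) `^ s * w i <= Z) ->
  \sum_(i <- r) Normc.normc (z i) `^ s * w i <= 2 `^ s * Z.
Proof.
move=> s0 w0 uz uZ.
have [M0 HM0] : exists M0, forall i, i \in r -> forall M, (M0 <= M)%N ->
    Normc.normc (z i) <= 2 * Normc.normc (u i M).
  elim: r {uZ} => [|i r [M0 IH]]; first by exists 0%N.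
  have [M1 HM1] : exists M1, forall M, (M1 <= M)%N ->
      Normc.normc (z i) <= 2 * Normc.normc (u i M).
    case: (uz i) => [->|/ccvg_eventually_half //].
    by exists 0%N => M _; rewrite Normc.normc0 mulr_ge0 ?normc_ge0.
  exists (maxn M0 M1) => j; rewrite inE => /predU1P[->|jr] M; rewrite geq_max => /andP[h0 h1].
    exact: HM1.
  exact: IH.
apply: le_trans (ler_wpM2l (powR_ge0 2 s) (uZ M0)).
rewrite mulr_sumr big_seq [leRHS]big_seq; apply: ler_sum => i ir.
rewrite mulrA ler_wpM2r // -powRM ?normc_ge0 //.
by apply: ge0_ler_powR; rewrite ?nnegrE ?mulr_ge0 ?normc_ge0 // HM0.
Qed.

(** * The pairing, the quasi-norm and sums over all multi-indices *)

Lemma HpX_pairing_cvg (R : realType) (d : nat) (p : R) (q : \bar R)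
    (X : set 'rV[R]_d) F phi lambda a :
  atomic_decomposition p q X F lambda a ->
  HpX_pairing p q X F phi = 0 \/
  ccvg (fun N => \sum_(j < N) lambda j * L2dot X (a j) phi) (HpX_pairing p q X F phi).
Proof.
move=> dec; rewrite /HpX_pairing; set S := [set z | _].
case: (xgetP 0 S) => [z _ Sz|_]; last by left.
by right; exact: Sz dec.
Qed.

Lemma lp_sum_partial_le (R : realType) (p : R) (lambda : nat -> R[i]) M :
  (lp_sum p lambda < +oo)%E ->
  \sum_(j < M) Normc.normc (lambda j) `^ p <= fine (lp_sum p lambda).
Proof.
move=> fin.
have lp0 : (0 <= lp_sum p lambda)%E.
  by apply: nneseries_ge0 => j _ _; rewrite lee_fin powR_ge0.
rewrite -lee_fin fineK ?ge0_fin_numE // -sumEFin /lp_sum.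
rewrite -(big_mkord predT (fun j => (Normc.normc (lambda j) `^ p)%:E)).
by apply: nneseries_lim_ge => j _ _; rewrite lee_fin powR_ge0.
Qed.

(** Every finite set of multi-indices lies in the box of its largest degree. *)
Lemma esum_box_le (R : realType) (d : nat) (F : {ffun 'I_d -> nat} -> R) (Z : R) :
  (forall n, 0 <= F n) -> (forall N, \sum_(n <- box d N) F n <= Z) ->
  (\esum_(n in [set: {ffun 'I_d -> nat}]) (F n)%:E <= Z%:E)%E.
Proof.
move=> F0 FZ; apply: ge_ereal_sup => _ [A [finA _] <-].
rewrite fsbig_finite //= sumEFin lee_fin.
pose N := (\max_(n <- fset_set A) mdeg n)%N.
apply: le_trans (FZ N); apply: ler_sum_uniq; rewrite ?box_uniq ?fset_uniq //.
by move=> n nA; rewrite mem_box /N (big_rem n) //= leq_maxl.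
Qed.

(** The hypothesis is solved for the quasi-norm: [(x / C)^(1/s)] is a lower bound over all
    decompositions, hence of the infimum, and no minimising sequence has to be chosen. *)
Lemma HpX_norm_bound (R : realType) (d : nat) (p s C : R) (q : \bar R)
    (X : set 'rV[R]_d) F (x : \bar R) :
  0 < p -> 0 < s -> 0 < C -> (0 <= x)%E ->
  (forall lambda a, atomic_decomposition p q X F lambda a ->
    (x <= (C * fine (lp_sum p lambda) `^ (s / p))%:E)%E) ->
  (x <= C%:E * HpX_norm p q X F `^ s)%E.
Proof.
move=> p0 s0 C0 x0 xC; rewrite /HpX_norm; set S := [set z | _].
(* Without any decomposition the infimum is [+oo], and so is the right-hand side because [C > 0]. *)
have [[_ [lambda0 [a0 [dec0 _]]]]|/set0P/negP/negPn/eqP ->] := pselect (S !=set0); last first.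
  by rewrite ereal_inf0 poweRyr ?lt0r_neq0 // mulry gtr0_sg // mul1e leey.
have xfin : x \is a fin_num.
  by rewrite ge0_fin_numE //; apply: le_lt_trans (xC _ _ dec0) _; exact: ltry.
rewrite -(fineK xfin); set y := fine x.
have y0 : 0 <= y by exact: fine_ge0.
pose b := (y / C) `^ s^-1.
have yb : y = C * b `^ s.
  rewrite /b -powRrM mulVf ?lt0r_neq0 // powRr1 ?divr_ge0 ?(ltW C0) //.
  by rewrite mulrCA divff ?mulr1 // lt0r_neq0.
have bS : (b%:E <= ereal_inf S)%E.
  apply: le_ereal_inf_tmp => _ [lambda [a [dec ->]]].
  have fin := ad_lp dec.
  have lp0 : (0 <= lp_sum p lambda)%E.
    by apply: nneseries_ge0 => j _ _; rewrite lee_fin powR_ge0.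
  have lpf : lp_sum p lambda \is a fin_num by rewrite ge0_fin_numE.
  have := xC _ _ dec; rewrite -(fineK xfin) -/y lee_fin => h.
  rewrite -(fineK lpf) poweR_EFin lee_fin.
  set L := fine (lp_sum p lambda) in h *.
  have -> : L `^ p^-1 = (L `^ (s / p)) `^ s^-1.
    by rewrite -powRrM; congr (_ `^ _); field; rewrite ?lt0r_neq0.
  apply: ge0_ler_powR; rewrite ?nnegrE ?invr_ge0 ?(ltW s0) ?divr_ge0 ?powR_ge0 ?(ltW C0) //.
  by rewrite ler_pdivrMr // mulrC.
rewrite yb EFinM lee_pmul2l // -poweR_EFin.
by apply: gt0_ler_poweR; rewrite ?(ltW s0) ?in_itv /= ?leey ?andbT ?lee_fin ?powR_ge0 //;
  apply: le_trans bS; rewrite lee_fin powR_ge0.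
Qed.

(** * The uniform bound on atoms and the conclusion *)

(** The constant is fixed before the atom and depends neither on the centre nor on the radius of its
    ball; superposition relies on this uniformity. *)
Lemma atom_weighted_sum_le (R : realType) (d : nat) (p s : R) (X : set 'rV[R]_d)
  (phi : {ffun 'I_d -> nat} -> 'rV[R]_d -> R[i])
  (K : R -> 'rV[R]_d -> 'rV[R]_d -> R[i])
  (gamma Ck : R) (Delta : seq R) (q : \bar R) :
  let nu := d%:R * (p^-1 - 1) in
  let P := Num.truncn nu in
  (0 < d)%N -> 0 < p -> p <= 1 -> p <= s -> s <= 2 -> open X ->
  orthonormal_basis X phi ->
  (forall r : R, 0 < r -> r < 1 -> is_integral_kernel X phi r (K r)) ->
  (forall (r : R) (y : 'rV[R]_d), 0 < r -> r < 1 -> X y -> cCn P X (fun x => K r x y)) ->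
  0 < gamma ->
  (forall delta : R, delta \in Delta -> 0 < delta /\ nu - P%:R < delta) ->
  (forall (r : R) (x x' : 'rV[R]_d),
    0 < r -> r < 1 -> X x -> X x' -> enorm (x - x') <= 2^-1 ->
    (cLnorm 2%:E X (taylor_remainder (K r) P x x')
     <= (Ck * \sum_(delta <- Delta)
          (1 - r) `^ (- (d%:R + 2 * P%:R + 2 * delta) * gamma)
          * enorm (x - x') `^ (P%:R + delta))%:E)%E) ->
  (2%:E <= q)%E ->
  let E := (2 - p) * s * d%:R * gamma / p + (2 - s) * d%:R / 2 in
  exists2 C : R, 0 <= C & forall a, atom p q a -> (forall x, ~ X x -> a x = 0) ->
    forall N, \sum_(n <- box d N)
      Normc.normc (L2dot X a (phi n)) `^ s / (mdeg n).+1%:R `^ E <= C.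
Proof.
move=> nu P d0 p0 p1 ps s2 oX onb kerK smK g0 DeltaP remK q2 E.
pose eta := d%:R * (p^-1 - 2^-1).
have dR : 0 < d%:R :> R by rewrite ltr0n.
have eta0 : 0 < eta.
  rewrite mulr_gt0 // subr_gt0 ltf_pV2 ?posrE //.
  by apply: le_lt_trans p1 _; rewrite ltr1n.
have s0 : 0 < s by apply: lt_le_trans ps.
have [a [a0 aeta aD]] : exists a : R, [/\ 0 < a, a <= eta &
    forall delta, delta \in Delta -> a <= P%:R + delta - nu].
  apply: uniform_lower_bound => // delta /DeltaP[_].
  by rewrite ltrBlDr addrC subr_gt0.
have D0 delta : delta \in Delta -> 0 < delta by case/DeltaP.
pose kappa := (2 - p) * d%:R * gamma / p.
have k0 : 0 <= kappa.
  rewrite divr_ge0 ?(ltW p0) // mulr_ge0 ?(ltW g0) // mulr_ge0 ?(ltW dR) //.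
  by rewrite subr_ge0 (le_trans p1) // ler1n.
have EE : E = kappa * s + (2 - s) * d%:R / 2.
  by rewrite /E /kappa; congr (_ + _); field; rewrite lt0r_neq0.
(* The hypothesis gives [Ck] no sign; its absolute value makes the remainder bound nonnegative. *)
pose C1 := block_const d p Delta a `|Ck|.
have C10 : 0 <= C1 by apply: block_const_ge0.
pose theta := 2 `^ (2 * gamma * a * s) : R.
exists (2 `^ E * (1 + C1) * (2 * (1 + theta) / (theta - 1))).
  have th1 : 1 < theta.
    have : 1 `^ (2 * gamma * a * s) < theta.
      by apply: gt0_ltr_powR; rewrite ?nnegrE ?ltr1n ?mulr_gt0.
    by rewrite powR1.
  have th0 : 0 <= theta by exact: powR_ge0.
  apply: mulr_ge0; first by rewrite mulr_ge0 ?powR_ge0 // addr_ge0.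
  by rewrite divr_ge0 ?subr_ge0 ?(ltW th1) // mulr_ge0 // addr_ge0.
move=> b [mb [c [rho [rho0 [bB bq bmom]]]]] bX N.
have [V [V0 BV rV]] := lebesgue_rV_eball c d0 rho0.
have c0 n : 0 <= Normc.normc (L2dot X b (phi n)) by exact: normc_ge0.
rewrite EE; apply: (dyadic_sum_le (rho := rho)) => // k; cbv zeta.
apply: (block_energy_le d0 p0 p1 g0 a0 aeta (normr_ge0 Ck) aD k rho0 rV).
  move=> N'; exact: (atom_coef_sum_le p0 q2 oX onb V0 BV mb bX bB bq).
move=> rho4 r N' r0 r1.
have rb0 : 0 <= remainder_bound d p gamma Delta `|Ck| r rho.
  by rewrite mulr_ge0 // sumr_ge0 // => delta _; rewrite mulr_ge0 ?powR_ge0.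
have := @atom_smoothed_coef_sum_le _ _ p q X phi p0 q2 oX onb b c rho V V0 BV mb bX bB bq bmom
  (K r) r _ N' rb0 (kerK r r0 r1) (fun y => smK r y r0 r1).
move=> H; have {H} := H _.
under eq_bigr do rewrite Normc.normcM normcR ger0_norm ?exprn_ge0 ?(ltW r0) //.
apply => x x' Xx Xx' xx'.
(* The condition [rho <= 1/4] keeps two points of the ball within the distance 1/2 allowed by
   [remK]. *)
have xx2 : enorm (x - x') <= 2^-1.
  by apply: le_trans (ltW xx') _; lra.
apply: le_trans (remK r x x' r0 r1 Xx Xx' xx2) _; rewrite lee_fin.
have S0 : 0 <= \sum_(delta <- Delta) (1 - r) `^ (- (d%:R + 2 * P%:R + 2 * delta) * gamma)
    * enorm (x - x') `^ (P%:R + delta).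
  by rewrite sumr_ge0 // => delta _; rewrite mulr_ge0 ?powR_ge0.
apply: le_trans (ler_wpM2r S0 (ler_norm Ck)) _; rewrite ler_wpM2l //.
rewrite big_seq [leRHS]big_seq; apply: ler_sum => delta dD.
rewrite ler_wpM2l ?powR_ge0 //; apply: ge0_ler_powR.
- by rewrite addr_ge0 ?ler0n // ltW // D0.
- by rewrite nnegrE enorm_ge0.
- by rewrite nnegrE mulr_ge0 // ltW.
- exact: ltW.
Qed.

Unset Implicit Arguments.
Set Strict Implicit.

Theorem theorem2p4 (R : realType) (d : nat) (p s : R) (X : set 'rV[R]_d)
  (phi : {ffun 'I_d -> nat} -> 'rV[R]_d -> R[i])
  (K : R -> 'rV[R]_d -> 'rV[R]_d -> R[i])
  (gamma : R) (Delta : {fset R})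
  (Phi : 'rV[R]_d -> R[i]) (q : \bar R) :
  let nu := d%:R * (p^-1 - 1) in
  let P := Num.truncn nu in
  (0 < d)%N -> 0 < p -> p <= 1 -> p <= s -> s <= 2 ->
  convex_lipschitz_domain X ->
  orthonormal_basis X phi ->
  (forall n, LambdaX nu X (phi n)) ->
  (forall r : R, 0 < r -> r < 1 -> is_integral_kernel X phi r (K r)) ->
  (forall (r : R) (y : 'rV[R]_d), 0 < r -> r < 1 -> X y -> cCn P X (fun x => K r x y)) ->
  0 < gamma ->
  (forall delta : R, delta \in Delta -> 0 < delta /\ nu - P%:R < delta) ->
  (forall k : nat, (k <= P)%N -> exists Ck : R,
    forall (r : R) (x x' : 'rV[R]_d),
    0 < r -> r < 1 -> X x -> X x' -> enorm (x - x') <= 2^-1 ->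
    (cLnorm 2%:E X (fun y => (K r x y -
       midx_sum k (fun n => cmderive n (fun z => K r z y) x' / (mfact n)%:R
                        * (monomial n (x - x'))%:C%C))%R)
     <= (Ck * \sum_(delta <- Delta)
          (1 - r) `^ (- (d%:R + 2 * k%:R + 2 * delta) * gamma)
          * enorm (x - x') `^ (k%:R + delta))%:E)%E) ->
  schwartz Phi -> cintegral setT Phi != 0 ->
  (2%:E <= q)%E ->
  let E := (2 - p) * s * d%:R * gamma / p + (2 - s) * d%:R / 2 in
  exists C : R, forall f, HpX Phi p X f ->
    (\esum_(n in [set: {ffun 'I_d -> nat}])
       (Normc.normc (HpX_pairing p q X f (phi n)) `^ s
        / ((mdeg n).+1%:R `^ E))%:E
     <= C%:E * HpX_norm p q X f `^ s)%E.
Proof.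
move=> nu P d0 p0 p1 ps s2 [oX _ _ _] onb _ kerK smK g0 DeltaP remK _ _ q2 E.
have s0 : 0 < s by apply: lt_le_trans ps.
have [Ck remP] := remK P (leqnn P).
have [C C0 atomC] := atom_weighted_sum_le d0 p0 p1 ps s2 oX onb kerK smK g0 DeltaP remP q2.
(* Adding 1 makes the constant positive, so that its product with an infinite quasi-norm is
   infinite. *)
pose C2 := 2 `^ s * C + 1.
have C20 : 0 < C2 by rewrite ltr_wpDl // mulr_ge0 ?powR_ge0.
exists C2 => f _.
have w0 (n : {ffun 'I_d -> nat}) : 0 <= ((mdeg n).+1%:R `^ E)^-1 :> R.
  by rewrite invr_ge0 powR_ge0.
apply: HpX_norm_bound => //.
  by apply: esum_ge0 => n _; rewrite lee_fin mulr_ge0 ?powR_ge0.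
move=> lambda a dec; apply: esum_box_le => [n|N]; first by rewrite mulr_ge0 ?powR_ge0.
have L0 : 0 <= fine (lp_sum p lambda).
  by apply: fine_ge0; apply: nneseries_ge0 => j _ _; rewrite lee_fin powR_ge0.
apply: (@le_trans _ _ (2 `^ s * (C * fine (lp_sum p lambda) `^ (s / p)))); last first.
  by rewrite mulrA ler_wpM2r ?powR_ge0 // lerDl.
apply: (ccvg_sum_le (u := fun n M => \sum_(j < M) lambda j * L2dot X (a j) (phi n))).
- exact: ltW.
- exact: w0.
- by move=> n; exact: HpX_pairing_cvg dec.
- move=> M.
  have atomCj j := atomC _ (ad_atom dec j) (fun x => ad_support dec j (x := x)) N.
  exact: (superposition_sum_le (c := fun j n => L2dot X (a j) (phi n))
    p0 p1 ps C0 w0 atomCj L0 (lp_sum_partial_le M (ad_lp dec))).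
Qed.
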